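(* For every $g\ge 1$, let $d_0=(3,\dots,3)$ (with $4g-2$ entries) be the degree partition of the cubic unicellular maps on the closed oriented surface $\Sigma_g$ of genus $g$. Then the combinatorial surgery graph $K_{d_0,g}$ is connected.
   Context: $\Sigma_g$ denotes a closed oriented surface of genus $g$. A unicellular map on $\Sigma_g$ is a finite graph $G=(V,E)$ (loops and multiple edges allowed) embedded in $\Sigma_g$ such that $\Sigma_g\setminus G$ is an open topological disk. All vertices are assumed to have degree greater than two. The degree partition of $G$ is the list $d=(d_1,\dots,d_n)$ of the degrees of its vertices. $G$ is cubic if all its vertices have degree $3$ (then $|V|=4g-2$ and $|E|=6g-3$). Cyclic order: each edge has two orientations, denoted $x$ and $\bar x$. Walking along $G$ and at each vertex continuing along the edge immediately to the right, one follows each oriented edge exactly once; this gives a cyclic order on the $2|E|$ oriented edges (it is the order in which they appear along the boundary of the disk $\Sigma_g\setminus G$, the disk lying on the right of each oriented edge). Surgery: for two oriented edges $x,y$ of $G$, let $\lambda_{x,y}$ be the unique simple arc (up to homotopy with endpoints gliding on $x$ and $y$), with interior in $\Sigma_g\setminus G$, leaving $x$ from its right side and arriving at $y$ on its right side. The surgery $\sigma_{x,y}(G)$ is the graph obtained from $G$ by removing a small open subarc of $x$ and a small open subarc of $y$ around the endpoints of $\lambda_{x,y}$ and reconnecting the four free ends by two parallel copies of $\lambda_{x,y}$ bounding a thin strip around $\lambda_{x,y}$. (So if $x$ goes from $a$ to $b$ and $y$ from $c$ to $d$, the two edges are replaced by an edge from $a$ to $d$ and an edge from $c$ to $b$.)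 The oriented edges $x,y$ are intertwined if in the cyclic order one sees $x<\bar x<y<\bar y$ or $x<\bar y<y<\bar x$ (equivalently $\lambda_{x,y}$ and $\lambda_{\bar x,\bar y}$ intersect once). The graph $\sigma_{x,y}(G)$ is unicellular if and only if $x$ and $y$ are intertwined, and surgeries are only considered in this case; they preserve the degree partition. The combinatorial surgery graph $K_{d,g}$ is the (undirected) graph whose vertices are the unicellular maps on $\Sigma_g$ with degree partition $d$, considered up to orientation-preserving homeomorphism of $\Sigma_g$, and in which two vertices are joined by an edge when they have representatives one of which is obtained from the other by a surgery. *)

(* Defs.v *)
From mathcomp Require Import all_boot perm.

Set Implicit Arguments.
Unset Strict Implicit.
Unset Printing Implicit Defensive.

(* A graph embedded in a closed oriented surface, with disk complementary     *)
(* regions, is encoded by its rotation system.  The darts D are the oriented  *)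
(* edges; [edge] reverses a dart; [vrot] sends a dart to the next dart,       *)
(* counterclockwise, with the same origin, so that the cycles of [vrot] are   *)
(* the vertices of the graph, with their degrees as lengths.                  *)
Definition rotsys (D : finType) : finType := ({perm D} * {perm D})%type.
Definition vrot (D : finType) (m : rotsys D) : {perm D} := m.1.
Definition edge (D : finType) (m : rotsys D) : {perm D} := m.2.

Section RotationSystems.
Variable D : finType.
Implicit Types (m : rotsys D) (x y z : D).

(* Arriving at the head of x, the dart reversing x points backwards; the      *)
(* outgoing dart immediately to the right is the next one counterclockwise.   *)
(* The cycles of [face m] are the boundary walks of the complementary         *)
(* regions, each region lying on the right of its darts.                      *)
Definition face m : {perm D} := (edge m * vrot m)%g.

Lemma faceE m x : face m x = vrot m (edge m x).
Proof. by rewrite permM. Qed.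

Definition edge_involution m :=
  [forall x, (edge m (edge m x) == x) && (edge m x != x)].

Definition degrees m : seq nat := [seq #|v| | v : {set D} in porbits (vrot m)].

(* Every complementary region being a disk, the genus is given by Euler's     *)
(* formula #vertices - #edges + #faces = 2 - 2g.  Having a single face makes  *)
(* the graph connected.                                                       *)
Definition has_genus m (g : nat) :=
  #|porbits (vrot m)| + #|porbits (face m)| + 2 * g == #|porbits (edge m)| + 2.

Definition unicellular m := #|porbits (face m)| == 1.

Definition is_umap (d : seq nat) (g : nat) m :=
  [&& edge_involution m, unicellular m, has_genus m g,
      all (fun k => 2 < k) (degrees m) & perm_eq (degrees m) d].

(* The list s consists of distinct darts, in the order in which they are met  *)
(* along one turn of the boundary of the face, starting at the first one.     *)
Definition cyclic_order m (s : seq D) :=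
  if s is a :: _ then subseq s (orbit (face m) a) else true.

Definition intertwined m x y :=
  cyclic_order m [:: x; edge m x; y; edge m y] ||
  cyclic_order m [:: x; edge m y; y; edge m x].

(* Conjugation by the transposition of x and y exchanges the starting ends    *)
(* of x and y: see [edge_surgery].                                            *)
Definition surgery m x y : rotsys D :=
  (vrot m, edge m ^ tperm x y)%g.

(* For x from a to b and y from c to d, the darts x, edge x, y, edge y        *)
(* leave a, b, c, d; after surgery x is the dart from a to d, with reverse    *)
(* the old reverse of y, and y is the dart from c to b.                       *)
Lemma edge_surgery m x y (m' := surgery m x y) :
    edge_involution m -> x != y -> edge m x != y ->
  [/\ edge m' x = edge m y, edge m' (edge m y) = x,
      edge m' y = edge m x, edge m' (edge m x) = y
    & forall z, z \notin [:: x; y; edge m x; edge m y] ->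
      edge m' z = edge m z].
Proof.
move=> /forallP inv xy exy.
have eK u : edge m (edge m u) = u by case/andP: (inv u) => /eqP.
have en u : u != edge m u by rewrite eq_sym; case/andP: (inv u).
have eyx : x != edge m y.
  by apply: contraNneq exy => ->; rewrite eK.
have E u : edge m' u = tperm x y (edge m (tperm x y u)).
  by rewrite /m' /= conjgE tpermV !permM.
have Ex : tperm x y (edge m x) = edge m x by rewrite tpermD // eq_sym.
have Ey : tperm x y (edge m y) = edge m y by rewrite tpermD.
split; rewrite ?E ?tpermL ?tpermR ?Ex ?Ey ?eK ?tpermL ?tpermR //.
move=> z; rewrite !inE !negb_or => /and4P[zx zy zex zey].
rewrite E [tperm x y z]tpermD ?[_ == z]eq_sym //.
rewrite tpermD //.
  by apply: contraNneq zex => ->; rewrite eK.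
by apply: contraNneq zey => ->; rewrite eK.
Qed.

(* An orientation-preserving homeomorphism mapping one embedded graph to      *)
(* the other is, up to isotopy, a bijection between oriented edges that       *)
(* respects reversal and the counterclockwise order around the vertices.      *)
Definition rotsys_iso : rel (rotsys D) := fun m1 m2 =>
  [exists s : {perm D}, forall x,
     (s (vrot m1 x) == vrot m2 (s x)) && (s (edge m1 x) == edge m2 (s x))].

Lemma rotsys_iso_equiv : equivalence_rel rotsys_iso.
Proof.
have isoP m1 m2 : reflect (exists s : {perm D}, forall x,
    s (vrot m1 x) = vrot m2 (s x) /\ s (edge m1 x) = edge m2 (s x))
    (rotsys_iso m1 m2).
  apply: (iffP existsP) => [[s /forallP h]|[s h]]; exists s.
    by move=> x; case/andP: (h x) => /eqP-> /eqP->.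
  by apply/forallP => x; case: (h x) => -> ->; rewrite !eqxx.
have tr m1 m2 m3 : rotsys_iso m1 m2 -> rotsys_iso m2 m3 -> rotsys_iso m1 m3.
  move=> /isoP[s h] /isoP[t k]; apply/isoP; exists (s * t)%g => x.
  by have [a b] := h x; have [c e] := k (s x); rewrite !permM a b c e.
have sy m1 m2 : rotsys_iso m1 m2 -> rotsys_iso m2 m1.
  move=> /isoP[s h]; apply/isoP; exists (s^-1)%g => x.
  have [a b] := h ((s^-1)%g x); rewrite permKV in a b.
  by rewrite -a -b !permK.
move=> m1 m2 m3; split.
  by apply/isoP; exists 1%g => x; rewrite !perm1.
move=> h; apply/idP/idP; last exact: tr.
by apply: tr; apply: sy.
Qed.

End RotationSystems.

(* A graph with degree partition d has sumn d oriented edges.  As the maps    *)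
(* are considered up to isomorphism, the labelling of the oriented edges by   *)
(* {0, ..., sumn d - 1} is immaterial.                                        *)
Definition umap (d : seq nat) (g : nat) : finType :=
  {m : rotsys 'I_(sumn d) | is_umap d g m}.

Section SurgeryGraph.
Variables (d : seq nat) (g : nat).

Definition umap_iso : rel (umap d g) := fun m1 m2 =>
  rotsys_iso (val m1) (val m2).

Definition surgery_step : rel (umap d g) := fun m1 m2 =>
  [exists x, exists y, intertwined (val m1) x y &&
     (val m2 == surgery (val m1) x y)].

Definition umap_class : finType :=
  {C : {set umap d g} | C \in equivalence_partition umap_iso [set: umap d g]}.

Definition surgery_graph : rel umap_class := fun C1 C2 =>
  [exists m1 in val C1, exists m2 in val C2,
     surgery_step m1 m2 || surgery_step m2 m1].

Lemma surgery_graph_sym : symmetric surgery_graph.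
Proof.
move=> C1 C2; apply/exists_inP/exists_inP => -[m1 h1 /exists_inP[m2 h2 h]];
  by exists m2 => //; apply/exists_inP; exists m1; rewrite // orbC.
Qed.

End SurgeryGraph.

Arguments surgery_graph : clear implicits.

(* The empty graph is not connected. *)
Definition connected_graph (T : finType) (e : rel T) :=
  (exists _ : T, True) /\ forall x y : T, connect e x y.

(* Main.v *)
(* A unicellular map is read as a cyclic word on the darts, in which every     *)
(* edge appears twice; a surgery on two non-crossing chords x A x' B y C y' D  *)
(* exchanges the arcs B and D.  A shortest chord of a cubic word yields a      *)
(* vertex whose three edges are mutually crossing chords, and surgeries        *)
(* shorten the arcs between them until two of the edges become parallel.  Then *)
(* either the map is the theta graph, or at most one more surgery turns the    *)
(* two parallel edges into a pendant torus, attached to the rest of the map by *)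
(* a bridge.  Deleting the torus lowers the genus by one.  A surgery between   *)
(* the bridge and the next edge lets the torus slide past the next vertex, and *)
(* repeating this visits all the places of the map because there is a single   *)
(* face: so the place of the torus does not matter, surgeries of the smaller   *)
(* map lift to the larger one, and one concludes by induction on the genus.    *)

Require Import Defs.
From mathcomp Require Import all_boot perm zify.

Set Implicit Arguments.
Unset Strict Implicit.
Unset Printing Implicit Defensive.

(** * Cubic cyclic words *)

(** A unicellular map is determined by its boundary walk: in the cyclic word [w] of its darts,
    reversal is [bar] and the vertex rotation is x -> [next w (bar x)]. Cubic maps of genus g thus
    become [cubic] words of 12g - 6 letters, and the heart of the proof is [cubic_eqv]: cubic words
    of equal length are related by rotations, renamings and surgeries.

    The induction on the length removes one torus, that is twelve letters, at a time. Reduction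
    ([cubic_reduce]): an innermost chord yields three mutually crossing edges at a vertex
    ([short_chord_crossing]), surgeries make two edges parallel ([crossing_digon]), and then the
    word is [theta] or can be given a torus hanging from a bridge ([digon_shape], [digon_pendant]),
    so that it is equivalent to [insw v] for a shorter cubic [v].

    Lifting ([insw_eqv]): equivalent words remain equivalent once a torus is attached to each.
    Renamings and surgeries lift directly ([insw_map], [insw_step]). A rotation changes the place of
    the torus; [slide] carries it past one vertex, and since the face is unique such slides reach
    every place ([insw_at_eqv]).

    Finally [represents] transports chains of moves on words to paths of the surgery graph
    ([represents_surgery], [eqv_conn]). *)

Definition letter := (nat * bool)%type.
Definition bar (x : letter) : letter := (x.1, ~~ x.2).

Lemma barK : involutive bar.
Proof. by case=> n b; rewrite /bar /= negbK. Qed.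

Lemma bar_inj : injective bar.
Proof. exact: inv_inj barK. Qed.

Lemma bar_neq x : (bar x == x) = false.
Proof. by case: x => n []; rewrite /bar xpair_eqE /= andbF. Qed.

Lemma neq_bar x : (x == bar x) = false.
Proof. by rewrite eq_sym bar_neq. Qed.

Lemma bar_eq x y : (bar x == bar y) = (x == y).
Proof. exact: inj_eq bar_inj x y. Qed.

Lemma eq_bar x y : (bar x == y) = (x == bar y).
Proof. by rewrite -{1}[y]barK bar_eq. Qed.

(** * Arcs of a cyclic word *)

Section Links.
Variable T : eqType.
Implicit Types (N : T -> T) (a b c x y z : T) (s w : seq T).

(** An arc together with both letters that bound it: an empty arc needs no separate case, and
    cutting at a letter gives two arcs ([lk_cat]). *)
Definition lk N a s b := path (frel N) a (rcons s b).

Lemma lk_nil N a b : lk N a [::] b = (N a == b).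
Proof. by rewrite /lk /= andbT. Qed.

Lemma lk_cons N a c s b : lk N a (c :: s) b = (N a == c) && lk N c s b.
Proof. by []. Qed.

Lemma lk_cat N a s1 c s2 b :
  lk N a (s1 ++ c :: s2) b = lk N a s1 c && lk N c s2 b.
Proof. by rewrite /lk -cat_rcons rcons_cat cat_path last_rcons. Qed.

Lemma lk_rcons N a s c b : lk N a (rcons s c) b = lk N a s c && (N c == b).
Proof. by rewrite -cats1 lk_cat lk_nil. Qed.

Definition lkE := (lk_nil, lk_cons, lk_cat, lk_rcons).

Lemma next_lk x s : uniq (x :: s) -> lk (next (x :: s)) x s x.
Proof. by move=> u; have := cycle_next u. Qed.

Lemma lk_next N x s : lk N x s x -> {in x :: s, next (x :: s) =1 N}.
Proof.
move=> l z zs; have c : cycle (frel N) (x :: s) by [].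
by have /= /eqP <- := next_cycle c zs.
Qed.

Lemma lk_transport N N' f a a' s b :
    N' a' = f (N a) -> {in s, forall z, N' z = f (N z)} -> {in s, f =1 id} ->
  lk N a s b -> lk N' a' s (f b).
Proof.
elim: s a a' => [|c s IH] a a' Ha HN Hf; rewrite !lkE.
  by move/eqP<-; rewrite Ha.
case/andP=> /eqP Hc l; rewrite Ha Hc Hf ?mem_head // eqxx /=.
apply: IH l => //; first by rewrite HN ?mem_head.
- by move=> z zs; apply: HN; rewrite inE zs orbT.
- by move=> z zs; apply: Hf; rewrite inE zs orbT.
Qed.

End Links.

(* The vertex rotation sends x to [next w (bar x)]; it must have order 3.     *)
Definition cubic (w : seq letter) :=
  [/\ uniq w, {in w, forall x, bar x \in w}
    & {in w, forall x, next w (bar x) != x /\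
       next w (bar (next w (bar (next w (bar x))))) = x}].

Definition switch (x y z : letter) :=
  if z == x then y else if z == y then x else z.

Lemma switchL x y : switch x y x = y.
Proof. by rewrite /switch eqxx. Qed.

Lemma switchR x y : switch x y y = x.
Proof. by rewrite /switch eqxx; case: eqP. Qed.

Lemma switchD x y z : z != x -> z != y -> switch x y z = z.
Proof. by rewrite /switch => /negPf-> /negPf->. Qed.

Lemma switchK x y : involutive (switch x y).
Proof.
move=> z; rewrite /switch; case: (z =P x) => [->|/eqP zx].
  by rewrite eqxx; case: eqP.
case: (z =P y) => [->|/eqP zy]; first by rewrite eqxx.
by rewrite (negPf zx) (negPf zy).
Qed.

Lemma bar_switch x y z : bar (switch x y z) = switch (bar x) (bar y) (bar z).
Proof. by rewrite /switch !bar_eq; case: (z == x); case: (z == y). Qed.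

Section Cubic.
Variable w : seq letter.
Hypothesis cw : cubic w.

Lemma cubic_uniq : uniq w. Proof. by case: cw. Qed.

Lemma mem_bar x : (bar x \in w) = (x \in w).
Proof.
case: cw => _ b _; apply/idP/idP; last exact: b.
by move/b; rewrite barK.
Qed.

Lemma cubic_next_bar a : a \in w -> next w a != bar a.
Proof.
by rewrite -mem_bar => aw; case: cw => _ _ /(_ _ aw) []; rewrite barK.
Qed.

(** A trivalent vertex has three corners along the boundary walk, and two of them determine the
    third. The shapes of words below are mostly derived from this. *)
Lemma cubic_vertex a b c : a \in w ->
  next w a = b -> next w (bar b) = c -> next w (bar c) = bar a.
Proof.
rewrite -mem_bar => aw <- <-.
by case: cw => _ _ /(_ _ aw) []; rewrite barK.
Qed.

Lemma cubic_next_neq a : a \in w -> next w a != a.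
Proof.
move=> aw; have [i s E] := rot_to aw.
have u : uniq (a :: s) by rewrite -E rot_uniq cubic_uniq.
have ba : bar a \in a :: s by rewrite -E mem_rot mem_bar.
rewrite -(next_rot i cubic_uniq) E; have := next_lk u.
case: s E u ba => [|b s] E u; first by rewrite inE bar_neq.
move=> _; rewrite lk_cons => /andP[/eqP-> _]; move: u.
by apply: contraTneq => ->; rewrite /= inE eqxx.
Qed.

Lemma cubic_rot n : cubic (rot n w).
Proof.
case: cw => u b c; split; first by rewrite rot_uniq.
  by move=> x; rewrite !mem_rot; apply: b.
by move=> x; rewrite mem_rot !next_rot //; apply: c.
Qed.

Lemma cubic_map f : injective f -> (forall x, f (bar x) = bar (f x)) ->
  cubic (map f w).
Proof.
move=> fi fb; case: cw => u b c; split; first by rewrite map_inj_uniq.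
  by move=> _ /mapP[x xw ->]; rewrite -fb map_f ?b.
move=> _ /mapP[x xw ->].
have nf y : next (map f w) (bar (f y)) = f (next w (bar y)).
  by rewrite -fb next_map.
by rewrite !nf (inj_eq fi); case: (c _ xw) => ? ->.
Qed.

End Cubic.

Lemma cubic_catC u v : cubic (u ++ v) -> cubic (v ++ u).
Proof. by move=> c; have := cubic_rot c (size u); rewrite rot_size_cat. Qed.

(* MoveStep is the surgery on x and y in the position x < bar x < y < bar y;  *)
(* the other intertwined position is not needed.                              *)
Inductive move : seq letter -> seq letter -> Prop :=
| MoveRot n w : move w (rot n w)
| MoveMap f w : injective f -> (forall x, f (bar x) = bar (f x)) ->
    move w (map f w)
| MoveStep x A B y C D :
    move (x :: A ++ bar x :: B ++ y :: C ++ bar y :: D)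
         (x :: A ++ bar x :: D ++ y :: C ++ bar y :: B).


(** * Membership and distinctness of letters as linear arithmetic on counts *)

Lemma mem_count (T : eqType) (z : T) s : (z \in s) = (0 < count_mem z s).
Proof. by rewrite -has_pred1 has_count. Qed.

Lemma count_cons (T : Type) (a : pred T) x s : count a (x :: s) = a x + count a s.
Proof. by []. Qed.

Lemma count_rcons (T : Type) (a : pred T) x s :
  count a (rcons s x) = count a s + a x.
Proof. by rewrite -cats1 count_cat /= addn0. Qed.

Definition countE := (count_cat, count_cons, count_rcons).

Lemma count_mem_cons (T : eqType) (z x : T) s :
  count_mem z (x :: s) = (z == x) + count_mem z s.
Proof. by rewrite /= eq_sym. Qed.

Lemma count_mem_rcons (T : eqType) (z x : T) s :
  count_mem z (rcons s x) = count_mem z s + (z == x).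
Proof. by rewrite count_rcons /= eq_sym. Qed.

Definition count_memE := (count_cat, count_mem_cons, count_mem_rcons).
Definition eq_barE := (eqxx, barK, bar_neq, neq_bar, eq_bar).

Lemma catrA (T : Type) (s1 s2 s3 : seq T) : (s1 ++ s2) ++ s3 = s1 ++ s2 ++ s3.
Proof. by rewrite catA. Qed.

Definition catE := (cat_cons, catrA, cat_rcons, cats0).

Lemma count_uniq_le (T : eqType) (z : T) s : uniq s -> count_mem z s <= 1.
Proof. by move=> u; rewrite count_uniq_mem ?leq_b1. Qed.

(* Uniqueness of the word u bounds by 1 the number of occurrences of z. *)
Ltac occ u z :=
  let H := fresh "occ" in
  have H := count_uniq_le z u; rewrite ?count_memE ?eq_barE /= in H.

Ltac count_mems :=
  repeat match goal with
  | H : is_true (in_mem _ _) |- _ =>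
    progress rewrite mem_count ?count_memE ?eq_barE /= in H
  | H : is_true (negb (in_mem _ _)) |- _ =>
    progress rewrite mem_count ?count_memE ?eq_barE /= in H
  end;
  rewrite ?mem_count ?count_memE ?eq_barE /=.

(* lia would branch on every boolean cast to nat. *)
Ltac bool_lia :=
  clear;
  change (nat_of_bool false) with 0; change (nat_of_bool true) with 1;
  repeat match goal with |- context [nat_of_bool ?b] =>
    let n := fresh "n" in move: (nat_of_bool b) => n end;
  repeat match goal with |- context [count ?a ?s] =>
    let n := fresh "n" in move: (count a s) => n end;
  rewrite -?leqNgt ?leqn0; lia.

Ltac occs :=
  count_mems;
  repeat match goal with
  | H : is_true (_ <= _) |- _ => revert H
  | H : is_true (~~ (_ <= _)) |- _ => revert H
  end;
  bool_lia.

Ltac neqs := rewrite -eqb0; occs.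

(** * The effect of a surgery on the successor function *)

Section Step.
Variables (x y : letter) (A B C D : seq letter).
Let w := x :: A ++ bar x :: B ++ y :: C ++ bar y :: D.
Let w' := x :: A ++ bar x :: D ++ y :: C ++ bar y :: B.

Lemma perm_step : perm_eq w w'.
Proof. apply/seq.permP => a; rewrite /w /w' !countE; lia. Qed.

(** Exchanging the arcs B and D interchanges what follows [bar x] and [bar y], and also the letters
    x and y met at the ends of B and D. Precomposed with [bar], this is a conjugation of the vertex
    rotation by [switch x y]. *)
Lemma next_step : uniq w -> {in w', forall z,
  next w' z = switch x y (next w (switch (bar x) (bar y) z))}.
Proof.
move=> u z zw; pose N z := switch x y (next w (switch (bar x) (bar y) z)).
rewrite -/(N z).
suff: lk N x (A ++ bar x :: D ++ y :: C ++ bar y :: B) x by move/lk_next/(_ _ zw).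
move: z {zw} => _.
have := next_lk u; rewrite -/w !lkE.
case/and4P=> lA lB lC lD.
have xy : x != y by apply/negP => /eqP e; rewrite /w e in u; occ u y; occs.
have xby : x != bar y.
  by apply/negP=> /eqP e; rewrite /w e in u; occ u (bar y); occs.
have H s z : z \in s -> (forall v, count_mem v s + (v == x) + (v == y) +
    (v == bar x) + (v == bar y) <= count_mem v w) ->
    [/\ z != x, z != y, z != bar x & z != bar y].
  move=> zs /(_ z); rewrite (count_uniq_mem z u).
  rewrite mem_count in zs => h; clear -zs h.
  by split; apply/negP=> e; move: h; rewrite e; case: (_ \in w); lia.
have H' s : (forall v, count_mem v s + (v == x) + (v == y) +
    (v == bar x) + (v == bar y) <= count_mem v w) -> forall a a' b,
   lk (next w) a s b -> switch (bar x) (bar y) a' = a ->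
   lk N a' s (switch x y b).
  move=> h a a' b l Ha; apply: (lk_transport _ _ _ l).
  - by rewrite /N Ha.
  - by move=> z /H/(_ h)[zx zy zbx zby]; rewrite /N [switch (bar x) _ z]switchD.
  - by move=> z /H/(_ h)[zx zy zbx zby]; rewrite switchD.
have cnt v : count_mem v w = count_mem v A + count_mem v B + count_mem v C +
    count_mem v D + (v == x) + (v == y) + (v == bar x) + (v == bar y).
  rewrite /w !count_memE /=; bool_lia.
apply/and4P; split.
- rewrite -[bar x](@switchD x y) ?bar_neq 1?eq_bar //.
  apply: H' lA _; first by move=> v; rewrite cnt; bool_lia.
  by rewrite switchD // neq_bar.
- rewrite -(switchL x y).
  by apply: H' lD _; rewrite ?switchL // => v; rewrite cnt; bool_lia.
- rewrite -[bar y](@switchD x y) ?bar_neq // 1?eq_sym //.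
  apply: H' lC _; first by move=> v; rewrite cnt; bool_lia.
  by rewrite switchD ?neq_bar // eq_sym eq_bar.
- rewrite -(switchR x y).
  by apply: H' lB _; rewrite ?switchR // => v; rewrite cnt; bool_lia.
Qed.

(** The new vertex rotation is conjugate to the old one, by [next_step], so its cycles keep their
    lengths. *)
Lemma cubic_step : cubic w -> cubic w'.
Proof.
move=> cw; have [u bw rw] := cw; have p := perm_step.
split; first by rewrite -(perm_uniq p).
  by move=> z; rewrite -!(perm_mem p); apply: bw.
have nx z : z \in w -> next w' (bar z) =
    switch x y (next w (bar (switch x y z))).
  move=> zw; rewrite next_step // -?(perm_mem p) ?(mem_bar cw) //.
  by rewrite bar_switch.
have sw z : z \in w -> switch x y z \in w.
  rewrite /switch; case: eqP => _.
    by move=> _; rewrite /w !(inE, mem_cat) eqxx !orbT.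
  by case: eqP => _ //; rewrite /w !(inE, mem_cat) eqxx.
move=> z; rewrite -(perm_mem p) => zw.
have [n1 n3] := rw _ (sw _ zw).
have m1 v : v \in w -> switch x y (next w (bar (switch x y v))) \in w.
  by move=> vw; rewrite sw // mem_next (mem_bar cw) sw.
rewrite !nx ?m1 // !switchK n3 switchK; split=> //.
by apply: contra n1 => /eqP{2}<-; rewrite switchK.
Qed.

End Step.

Lemma move_cubic w w' : move w w' -> cubic w -> cubic w'.
Proof.
case=> [n v|f v fi fb|x A B y C D] c; [exact: cubic_rot|exact: cubic_map|].
exact: cubic_step.
Qed.

(** Moves start from cubic words only, which makes cubicity an invariant in both directions
    ([eqv_cubic]). *)
Inductive eqv : seq letter -> seq letter -> Prop :=
| EqvMove w w' : cubic w -> move w w' -> eqv w w'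
| EqvRefl w : eqv w w
| EqvSym w w' : eqv w w' -> eqv w' w
| EqvTrans w1 w2 w3 : eqv w1 w2 -> eqv w2 w3 -> eqv w1 w3.

Lemma eqv_cubic w w' : eqv w w' -> cubic w <-> cubic w'.
Proof.
elim=> // [v v' c /move_cubic/(_ c) c'|v v' _ h|v1 v2 v3 _ h _ h'].
- by split.
- exact: iff_sym.
- exact: iff_trans h h'.
Qed.

Lemma eqv_size w w' : eqv w w' -> size w = size w'.
Proof.
elim=> // [v v' _ [n u|f u _ _|x A B y C D]|v1 v2 v3 _ -> _ -> //].
- by rewrite size_rot.
- by rewrite size_map.
- exact: perm_size (perm_step _ _ _ _ _ _).
Qed.

Lemma eqv_catC u v : cubic (u ++ v) -> eqv (u ++ v) (v ++ u).
Proof. by move=> c; rewrite -(rot_size_cat u v); apply: EqvMove c (MoveRot _ _). Qed.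

Lemma eqv_map f w : cubic w -> injective f ->
  (forall x, f (bar x) = bar (f x)) -> eqv w (map f w).
Proof. by move=> c fi fb; apply: EqvMove c (MoveMap _ fi fb). Qed.

Lemma eqv_step x A B y C D :
  cubic (x :: A ++ bar x :: B ++ y :: C ++ bar y :: D) ->
  eqv (x :: A ++ bar x :: B ++ y :: C ++ bar y :: D)
      (x :: A ++ bar x :: D ++ y :: C ++ bar y :: B).
Proof. by move=> c; apply: EqvMove c (MoveStep _ _ _ _ _ _). Qed.

(** * Reduction to a pendant torus *)

(** This places a whole corner of a vertex inside an arc once its first letter is known to lie
    there. *)
Lemma lk_split (T : eqType) (N : T -> T) a s b p q :
  lk N a s b -> p \in s -> N p = q -> q != b ->
  exists s1 s2, s = s1 ++ p :: q :: s2.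
Proof.
move=> l ps E qb; case/splitPr: ps l => s1 [|q' s2]; rewrite !lkE.
  by case/andP=> _; rewrite E (negPf qb).
by case/and3P=> _; rewrite E => /eqP<- _; exists s1, s2.
Qed.

Lemma eqv_catC_cubic u v w : cubic (u ++ v) -> eqv (v ++ u) w -> eqv (u ++ v) w.
Proof. by move=> c; apply: EqvTrans; apply: eqv_catC. Qed.


Lemma next_inj (w : seq letter) : uniq w -> injective (next w).
Proof. by move=> u; apply: can_inj (prev_next u). Qed.

(* The darts bar p, b, c turn around a vertex, and their three edges are      *)
(* mutually crossing chords of w.                                             *)
Definition crossing w := exists p b c U V W,
  eqv w (p :: b :: U ++ bar c :: bar p :: V ++ bar b :: c :: W).

(** A chord with both ends in A cuts off a shorter arc, so induction applies. If there is none, the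
    first letter b and the last letter d of A are the other two edges at the head of x; [bar b] is
    followed by [bar d] and lies beyond [bar x], so the three chords cross. *)
Lemma short_chord_crossing n x A R :
  size A < n -> cubic (x :: A ++ bar x :: R) -> crossing (x :: A ++ bar x :: R).
Proof.
elim: n x A R => // n IH x A R An cw.
have u := cubic_uniq cw.
have [/hasP[z zA bzA]|/hasPn nA] := boolP (has (fun z => bar z \in A) A).
  have [z' [A1 [A2 [A3 E]]]] :
      exists z' A1 A2 A3, A = A1 ++ z' :: A2 ++ bar z' :: A3.
    case/splitPr: A / zA An cw u bzA => A1 A2 An cw u.
    rewrite mem_cat inE bar_neq /= => /orP[] /splitPr[B1 B2].
      by exists (bar z), B1, B2, A2; rewrite barK -catA.
    by exists z, A1, B1, B2.
  have Ew : x :: A ++ bar x :: R =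
      (x :: A1) ++ (z' :: A2 ++ bar z' :: (A3 ++ bar x :: R)).
    by rewrite E !catE.
  rewrite Ew in cw *;  have cw' := cubic_catC cw.
  have h1 : size A2 < n.
    by move: An; rewrite E !size_cat /= size_cat /=; lia.
  have h2 : cubic (z' :: A2 ++ bar z' :: ((A3 ++ bar x :: R) ++ x :: A1)).
    by move: cw'; rewrite !catE.
  have [p [b [c [U [V [W e]]]]]] := IH _ _ _ h1 h2; exists p, b, c, U, V, W.
  by apply: eqv_catC_cubic cw _; move: e; rewrite !catE.
have xw := mem_head x (A ++ bar x :: R).
have l := next_lk u.
(* A has at least two letters: if empty, [bar x] would follow x; if reduced to b, [bar b] would
   follow itself. *)
case: A An nA cw u xw l => [|b A] An nA cw u xw.
  rewrite cat0s !lkE; by case/andP=> E; have /negP[] := cubic_next_bar cw xw.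
case/lastP: A An nA cw u xw => [|A d] An nA cw u xw.
  rewrite !lkE; case/and3P=> /eqP E1 /eqP E2 _.
  have E3 := cubic_vertex cw xw E1 erefl.
  have := next_inj u (etrans E3 (esym E2)) => E4.
  have /(cubic_next_neq cw) : bar b \in [:: x, b, bar x & R].
    by rewrite (mem_bar cw) !inE eqxx orbT.
  by rewrite -[next _ (bar b)]barK E4 eqxx.
rewrite !catE !lkE in cw u xw *.
case/and4P=> /eqP E1 l1 /eqP E2 l2.
have E3 := cubic_vertex cw xw E1 erefl.
have E4 := next_inj u (etrans E3 (esym E2)).
have bw : bar b \in [:: x, b & A ++ d :: bar x :: R].
  by rewrite (mem_bar cw) !inE eqxx orbT.
have bR : bar b \in R.
  by occ u (bar b); occ u b; have nb := nA b (mem_head _ _); occs.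
have [R1 [R2 E]] : exists R1 R2, R = R1 ++ bar b :: bar d :: R2.
  apply: lk_split l2 bR _ _; first by rewrite -[LHS]barK E4.
  by occ u d; neqs.
exists x, b, (bar d), A, R1, R2; rewrite barK E; exact: EqvRefl.
Qed.

Lemma cubic_crossing x s : cubic (x :: s) -> crossing (x :: s).
Proof.
move=> cw; have := mem_bar cw x; rewrite mem_head inE bar_neq /=.
by move=> xs; case/splitPr: xs cw => A R; apply: short_chord_crossing.
Qed.

(** In a cubic word of this shape, y and [bar z] leave the head of x, while [bar y] and z share
    their origin: y and z are parallel edges. *)
Definition digon w := exists x y z R, eqv w (x :: y :: z :: bar x :: R).

Lemma digon_eqv w1 w2 : eqv w1 w2 -> digon w2 -> digon w1.
Proof.
by move=> e [x [y [z [R e']]]]; exists x, y, z, R; apply: EqvTrans e e'.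
Qed.

Lemma digon_catC s1 s2 : cubic (s1 ++ s2) -> digon (s2 ++ s1) -> digon (s1 ++ s2).
Proof. by move=> c; apply/digon_eqv/eqv_catC. Qed.

Lemma digon_infix s1 x y z s2 : cubic (s1 ++ x :: y :: z :: bar x :: s2) ->
  digon (s1 ++ x :: y :: z :: bar x :: s2).
Proof.
move=> c; apply: digon_catC c _; rewrite !catE.
by exists x, y, z, (s2 ++ s1); apply: EqvRefl.
Qed.

Lemma digon_step x A B y C D w :
    w = x :: A ++ bar x :: B ++ y :: C ++ bar y :: D -> cubic w ->
    (cubic (x :: A ++ bar x :: D ++ y :: C ++ bar y :: B) ->
     digon (x :: A ++ bar x :: D ++ y :: C ++ bar y :: B)) ->
  digon w.
Proof.
by move=> -> c h; apply: digon_eqv (eqv_step c) (h (cubic_step c)).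
Qed.

Lemma digon_rot s1 s2 w : w = s1 ++ s2 -> cubic w ->
  (cubic (s2 ++ s1) -> digon (s2 ++ s1)) -> digon w.
Proof. by move=> -> c h; apply: digon_catC c (h (cubic_catC c)). Qed.

(* A surgery that creates no parallel edges makes another arc shorter than V, *)
(* and rotating the names of the edges makes this arc the new V.              *)
Lemma crossing_digon n p b c U V W : size V < n ->
  cubic (p :: b :: U ++ bar c :: bar p :: V ++ bar b :: c :: W) ->
  digon (p :: b :: U ++ bar c :: bar p :: V ++ bar b :: c :: W).
Proof.
elim: n p b c U V W => // n IH p b c U V W Vn cw.
have u := cubic_uniq cw; have l := next_lk u.
(* If W or U is empty, [bar b], c, p, b or p, b, [bar c], [bar p] are already consecutive. *)
case: W cw u l => [|w1 W] cw u l.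
  have E : p :: b :: U ++ bar c :: bar p :: V ++ [:: bar b; c] =
     (p :: b :: U ++ bar c :: bar p :: V) ++ [:: bar b; c] by rewrite !catE.
  rewrite E in cw *; apply: (digon_catC cw).
  have := @digon_infix [::] (bar b) c p (U ++ bar c :: bar p :: V).
  by rewrite barK; apply; apply: cubic_catC cw.
case/lastP: U cw u l => [|U u1] cw u l; first exact: (@digon_infix [::]).
rewrite !catE in cw u l *; rewrite !lkE in l.
case/and5P: l => _ lU /eqP E1 _ /and4P[lV _ /eqP E2 lW].
set w := p :: _ in E1 E2 lU lV lW.
have u1w : u1 \in w by rewrite /w; count_mems; bool_lia.
(* The far end of c carries [bar c], w1 and [bar u1]; the position of [bar w1] decides which surgery
   is made. *)
have E3 : next w (bar w1) = bar u1.
  by apply: (cubic_vertex cw u1w E1); rewrite barK.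
have : bar w1 \in w by rewrite (mem_bar cw) /w; count_mems; bool_lia.
(* If [bar w1] is in W, surgery on p and w1 makes [bar b], c, p, b consecutive. *)
have [w1W _|w1W] := boolP (bar w1 \in W).
  case/splitPr: w1W @w cw u lW u1w E1 E2 E3 lU lV => W2 W3 w cw *.
  apply: (digon_step (x := p) (A := b :: U ++ [:: u1; bar c])
    (B := V ++ [:: bar b; c]) (y := w1) (C := W2) (D := W3) _ cw).
    by rewrite /w !catE.
  rewrite !catE => c1.
  apply: (digon_rot (s1 := p :: b :: U ++
    [:: u1, bar c, bar p & W3 ++ w1 :: W2 ++ bar w1 :: V])
    (s2 := [:: bar b; c]) _ c1); first by rewrite !catE.
  rewrite !catE => c2.
  by have := @digon_infix [::] (bar b) c p; rewrite barK; apply.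
(* If it is in U, surgery on [bar b] and [bar u1] makes p, b, [bar c], [bar p] consecutive. *)
have [w1U _|w1U] := boolP (bar w1 \in U).
  have [|U1 [U2 E]] := lk_split lU w1U E3.
    by rewrite bar_neq.
  rewrite E !catE in cw u *.
  apply: (digon_rot (s1 := p :: b :: U1 ++ bar w1 :: bar u1 :: U2 ++
    [:: u1, bar c, bar p & V]) (s2 := bar b :: c :: w1 :: W) _ cw).
    by rewrite !catE.
  rewrite !catE => c1.
  apply: (digon_step (x := bar b) (A := c :: w1 :: W ++ [:: p])
    (B := U1 ++ [:: bar w1]) (y := bar u1) (C := U2)
    (D := bar c :: bar p :: V) _ c1); first by rewrite !barK !catE.
  rewrite !barK !catE => c2.
  have := @digon_infix (bar b :: c :: w1 :: W) p b (bar c) 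
    (V ++ bar u1 :: U2 ++ u1 :: U1 ++ [:: bar w1]).
  by rewrite !catE; apply.
move=> w1w.
have w1V : bar w1 \in V.
  have n1 : (w1 == bar u1) = false.
    apply/negP=> /eqP e; move: E3; rewrite e barK E1 => /bar_inj ec.
    by rewrite ec /w in u; occ u u1; occs.
  rewrite /w in w1w u; occ u w1.
  rewrite mem_count ?count_memE ?eq_barE n1 in w1w; occs.
have [|V1 [V2 E]] := lk_split lV w1V E3.
  occ u u1. neqs.
rewrite E !catE in cw u Vn *.
apply: (digon_step (x := p) (A := b :: U ++ [:: u1; bar c])
    (B := V1) (y := bar w1) (C := bar u1 :: V2 ++ [:: bar b; c])
    (D := W) _ cw); first by rewrite !barK !catE.
rewrite !barK !catE => c1.
apply: (digon_rot (s1 := p :: b :: U ++ [:: u1]) (s2 := bar c :: bar p ::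
  W ++ bar w1 :: bar u1 :: V2 ++ [:: bar b, c, w1 & V1]) _ c1).
  by rewrite !catE.
rewrite !catE => c2.
(* With [bar c], [bar p], b in the roles of p, b, c, the new arc is [w1 :: V1], shorter than [V] by
   at least one letter. *)
have := IH (bar c) (bar p) b (W ++ bar w1 :: bar u1 :: V2) (w1 :: V1)
  (U ++ [:: u1]); rewrite !barK !catE; apply=> //.
by move: Vn; rewrite /= size_cat /=; lia.
Qed.

(** The corner at the head of x makes [bar y] and [bar z] consecutive, and the third edge w at the
    head of y flanks them on both sides. The theta word is the case w = x. *)
Lemma digon_shape x y z R : cubic (x :: y :: z :: bar x :: R) ->
  R = [:: bar y; bar z] \/
  exists w B C, R = B ++ bar w :: bar y :: bar z :: w :: C.
Proof.
move=> cw; have u := cubic_uniq cw; have l := next_lk u.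
rewrite !lkE in l; case/and4P: l => /eqP Ex /eqP Ey /eqP Ez lR.
set s := x :: _ in cw u Ex Ey Ez lR.
have xs : x \in s by apply: mem_head.
have ys : y \in s by rewrite /s; count_mems; bool_lia.
have zs : z \in s by rewrite /s; count_mems; bool_lia.
have bxs : bar x \in s by rewrite mem_bar.
have bys : bar y \in s by rewrite mem_bar.
have Ezb : next s (bar y) = bar z.
  have H := cubic_vertex cw zs Ez; rewrite barK Ex in H.
  exact: H erefl.
have yR : bar y \in R.
  have n1 : (y == bar z) = false.
    by apply/negP=> /eqP e; have := cubic_next_bar cw ys; rewrite Ey e barK eqxx.
  rewrite /s in u bys; occ u y; rewrite mem_count ?count_memE ?eq_barE n1 in bys.
  occs.
have [|R1 [R2 E]] := lk_split lR yR Ezb.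
  by rewrite /s in u; occ u z; neqs.
rewrite {1}E in lR.
case: R2 E lR => [|w R3] E; rewrite !lkE.
  case/and3P=> lR1 _ /eqP Ew; left.
  have Exw := cubic_vertex cw ys Ey Ew.
  case: R1 E lR1 => [|f R1] E; first by rewrite E.
  rewrite !lkE Exw => /andP[/eqP e _].
  by rewrite /s E -e !catE in u; occ u (bar y); occs.
case/and4P=> lR1 _ /eqP Ew _; right.
have Ew' := cubic_vertex cw ys Ey Ew.
case/lastP: R1 E lR1 => [|B v] E; rewrite !lkE.
  move/eqP=> e; have := next_inj u (etrans Ew' (esym e)) => /bar_inj ewx.
  by rewrite /s E ewx in u; occ u x; occs.
case/andP=> _ /eqP e; have E' := next_inj u (etrans Ew' (esym e)).
by exists w, B, R3; rewrite E E' catE.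
Qed.

(** The edges x, y, z, w' span three vertices and have a neighbourhood that is a torus with one
    hole; the last dart at the vertex shared by x and w' is the bridge ([pendant_bridge]). *)
Definition pendant w := exists x y z w' C,
  eqv w (x :: y :: z :: bar x :: bar w' :: bar y :: bar z :: w' :: C).

Lemma pendant_eqv w1 w2 : eqv w1 w2 -> pendant w2 -> pendant w1.
Proof.
move=> e [x [y [z [w [C e']]]]]; exists x, y, z, w, C; exact: EqvTrans e e'.
Qed.

Lemma pendant_catC s1 s2 w : w = s1 ++ s2 -> cubic w ->
  (cubic (s2 ++ s1) -> pendant (s2 ++ s1)) -> pendant w.
Proof.
by move=> -> c h; apply: pendant_eqv (eqv_catC c) (h (cubic_catC c)).
Qed.

Lemma pendant_step x A B y C D w :
    w = x :: A ++ bar x :: B ++ y :: C ++ bar y :: D -> cubic w ->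
    (cubic (x :: A ++ bar x :: D ++ y :: C ++ bar y :: B) ->
     pendant (x :: A ++ bar x :: D ++ y :: C ++ bar y :: B)) ->
  pendant w.
Proof.
by move=> -> c h; apply: pendant_eqv (eqv_step c) (h (cubic_step c)).
Qed.

Lemma pendantl x y z w C :
  pendant (x :: y :: z :: bar x :: bar w :: bar y :: bar z :: w :: C).
Proof. by exists x, y, z, w, C; apply: EqvRefl. Qed.

Lemma pendantr x y z w B :
  cubic (x :: y :: z :: bar x :: B ++ [:: bar w; bar y; bar z; w]) ->
  pendant (x :: y :: z :: bar x :: B ++ [:: bar w; bar y; bar z; w]).
Proof.
move=> cw; apply: (pendant_catC (s1 := x :: y :: z :: bar x :: B)) _ cw _ => //.
move=> _; have := pendantl (bar w) (bar y) (bar z) (bar x) B.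
by rewrite !barK.
Qed.

(** If B or C is empty, the torus is already there. Otherwise the first letter f of B and the last
    letter v of C are the other two edges at the origin of x. One surgery closes a gap: on [bar w]
    and f if [bar f] is in B, on [bar w] and [bar v] if it is in C. *)
Lemma digon_pendant x y z w B C :
  cubic (x :: y :: z :: bar x :: B ++ bar w :: bar y :: bar z :: w :: C) ->
  pendant (x :: y :: z :: bar x :: B ++ bar w :: bar y :: bar z :: w :: C).
Proof.
case: B => [|f B] cw; first exact: pendantl.
case/lastP: C cw => [|C v] cw; first exact: pendantr.
have u := cubic_uniq cw; have l := next_lk u.
rewrite !catE in cw u l *; rewrite !lkE in l.
case/and5P: l => /eqP Ex /eqP Ey /eqP Ez /eqP Ebx /and5P[lB _ _ _ /andP[lC /eqP Ev]].
set s := x :: _ in Ex Ey Ez Ebx lB lC Ev.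
have vs : v \in s by rewrite /s; count_mems; bool_lia.
have Ef : next s (bar f) = bar v.
  by apply: (cubic_vertex cw vs Ev).
have fs : bar f \in s by rewrite mem_bar // /s; count_mems; bool_lia.
have [fB|fB] := boolP (bar f \in B).
  move: (fB) cw; case/splitPr => B2 B3 cw.
  apply: (pendant_catC (s1 := x :: y :: z :: bar x :: f :: B2 ++ bar f :: B3)
    (s2 := bar w :: bar y :: bar z :: w :: rcons C v) _ cw).
    by rewrite !catE.
  rewrite !catE => c1.
  apply: (pendant_step (x := bar w) (A := [:: bar y; bar z])
    (B := C ++ [:: v; x; y; z; bar x]) (y := f) (C := B2) (D := B3) _ c1).
    by rewrite barK !catE.
  rewrite barK => c2.
  apply: (pendant_catC (s1 := bar w :: bar y :: bar z :: w :: B3 ++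
      f :: B2 ++ bar f :: C ++ [:: v])
    (s2 := [:: x; y; z; bar x]) _ c2); first by rewrite !catE.
  by move=> _; apply: pendantl.
have fC : bar f \in C.
  have n1 : (f == bar v) = false.
    apply/negP=> /eqP e; move: Ef; rewrite e barK Ev => ex.
    by move: u; rewrite e ex /= !(inE, mem_cat) eqxx !orbT.
  rewrite /s in fs u; occ u f; rewrite mem_count ?count_memE ?eq_barE n1 in fs.
  occs.
have [|C1 [C2 E]] := lk_split lC fC Ef; first by rewrite bar_neq.
rewrite E rcons_cat /= -cats1 in cw u *.
apply: (pendant_catC (s1 := x :: y :: z :: bar x :: f :: B)
    (s2 := bar w :: bar y :: bar z :: w :: C1 ++ bar f :: bar v :: C2 ++ [:: v]) _ cw).
  by rewrite !catE.
rewrite !catE => c1.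
apply: (pendant_step (x := bar w) (A := [:: bar y; bar z])
    (B := C1 ++ [:: bar f]) (y := bar v) (C := C2)
    (D := x :: y :: z :: bar x :: f :: B) _ c1).
  by rewrite !barK !catE.
rewrite !barK => c2.
apply: (pendant_catC (s1 := [:: bar w; bar y; bar z; w]) _ c2) => //.
rewrite !catE => c3.
have := @pendantr x y z w (f :: B ++ bar v :: C2 ++ v :: C1 ++ [:: bar f]).
by rewrite !catE; apply.
Qed.

(** The vertex carrying x and [bar w] has one more dart, so the letter after w is the reverse of the
    letter cyclically before x. *)
Lemma pendant_bridge x y z w C :
  cubic (x :: y :: z :: bar x :: bar w :: bar y :: bar z :: w :: C) ->
  exists k D, C = bar k :: rcons D k.
Proof.
move=> cw; have u := cubic_uniq cw; have l := next_lk u.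
rewrite !lkE in l; case/and5P: l => /eqP Ex /eqP Ey /eqP Ez /eqP Ebx.
case/and4P=> /eqP Ebw /eqP Eby /eqP Ebz lC.
set s := x :: _ in cw u Ex Ey Ez Ebx Ebw Eby Ebz lC.
have xs : x \in s by apply: mem_head.
have bxs : bar x \in s by rewrite mem_bar.
have ws : bar w \in s by rewrite /s; count_mems; bool_lia.
case: C @s cw u xs bxs ws Ex Ey Ez Ebx Ebw Eby Ebz lC =>
  [|c C] s cw u xs bxs ws Ex Ey Ez Ebx Ebw Eby Ebz.
  rewrite !lkE => /eqP Ew; have := cubic_vertex cw bxs Ebx.
  by rewrite !barK => /(_ _ Ew) e; have := cubic_next_bar cw bxs; rewrite e barK eqxx.
have cs : c \in s by rewrite /s; count_mems; bool_lia.
case/lastP: C @s cw u xs bxs ws cs Ex Ey Ez Ebx Ebw Eby Ebz =>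
  [|C k] s cw u xs bxs ws cs Ex Ey Ez Ebx Ebw Eby Ebz; rewrite !lkE.
  case/andP=> /eqP Ew /eqP Ec; have := cubic_vertex cw bxs Ebx.
  rewrite !barK => /(_ _ Ew) Ec'.
  by have /eqP := next_inj u (etrans Ec' (esym Ec)); rewrite bar_neq.
case/and3P=> /eqP Ew lC /eqP Ek; have Ec := cubic_vertex cw bxs Ebx.
rewrite !barK in Ec; have {Ec} := next_inj u (etrans (Ec _ Ew) (esym Ek)).
by move=> Ec; exists k, C; rewrite -Ec barK.
Qed.


(** The other two edges at the far end of the bridge are e and e1, so [bar e1] follows [bar e];
    closure of C under [bar] keeps this corner inside C. *)
Lemma bridge_shape A k C :
    cubic (A ++ bar k :: rcons C k) -> {in C, forall x, bar x \in C} ->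
  exists e e1 V1 V2, C = e :: V1 ++ bar e :: bar e1 :: rcons V2 e1.
Proof.
move=> /cubic_catC; rewrite !catE => cw bC.
have u := cubic_uniq cw; have l := next_lk u; have ks := mem_head (bar k) (C ++ k :: A).
case: C cw bC u l ks => [|e C] cw bC u l ks.
  by case/andP: l => /eqP Ek _; have := cubic_next_bar cw ks; rewrite Ek barK eqxx.
have := bC e; rewrite mem_head inE bar_neq => /(_ isT) /= eC.
case/lastP: C eC cw bC u l ks => // C e1 eC cw bC u l ks.
rewrite !catE !lkE in cw u l *.
set s := bar k :: _ in cw u l.
case/and4P: l => /eqP Ek lC /eqP Ee1 _.
have e1s : e1 \in s by rewrite /s; count_mems; bool_lia.
have Ee : next s (bar e) = bar e1 by apply: (cubic_vertex cw e1s Ee1).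
have n1 : (bar e == e1) = false.
  apply/negP=> /eqP e'; move: Ee; rewrite e' Ee1 -e' barK => ex.
  by rewrite /s ex in u; occ u e; occs.
rewrite mem_rcons inE n1 /= in eC.
have [|C1 [C2 E]] := lk_split lC eC Ee; first by rewrite bar_neq.
by exists e, e1, C1, C2; rewrite E rcons_cat.
Qed.

Lemma pendant_shape x y z w C :
  cubic (x :: y :: z :: bar x :: bar w :: bar y :: bar z :: w :: C) ->
  exists k e e1 V1 V2,
    C = bar k :: e :: V1 ++ bar e :: bar e1 :: V2 ++ [:: e1; k].
Proof.
move=> cw; have [k [D E]] := pendant_bridge cw; subst C.
have [] := @bridge_shape [:: x; y; z; bar x; bar w; bar y; bar z; w] _ _ cw.
  move=> v vD; have u := cubic_uniq cw.
  have : bar v \in [:: x; y; z; bar x; bar w; bar y; bar z; w] ++ bar k :: rcons D k.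
    by rewrite (mem_bar cw) !(inE, mem_cat, mem_rcons) vD !orbT.
  by move=> bvs; occ u v; occs.
move=> e [e1 [V1 [V2 ->]]]; exists k, e, e1, V1, V2.
by rewrite !(rcons_cons, rcons_cat) -!cats1 catrA.
Qed.

(** * Attaching a pendant torus *)

Lemma count_sub_uniq (T : eqType) (s1 s2 : seq T) : uniq s2 ->
  (forall a, count_mem a s1 <= count_mem a s2) -> uniq s1.
Proof.
move=> u2 h; have {u2}h a : count_mem a s1 <= 1.
  exact: leq_trans (h a) (count_uniq_le a u2).
elim: s1 h => //= b s IH h; apply/andP; split.
  by have := h b; rewrite eqxx -has_pred1 has_count; case: (count _ s).
by apply: IH => a; have := h a; case: (b == a) => //; case: (count _ s).
Qed.

(* The edge e of the word e V1 e' V2 is cut into e1 and e, and between them a *)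
(* torus carrying the edges x, y, z, w hangs at the end of the bridge k.      *)
Definition attach e1 k x y z w e V1 V2 : seq letter :=
  e1 :: k :: x :: y :: z :: bar x :: bar w :: bar y :: bar z :: w :: bar k
  :: e :: V1 ++ bar e :: bar e1 :: V2.

Section Attach.
Variables (e1 k x y z w e : letter) (V1 V2 : seq letter).
Let W := attach e1 k x y z w e V1 V2.
Let v := e :: V1 ++ bar e :: V2.
Hypothesis u : uniq W.

(** To read successors of the uncut word in [W], leave [bar e] from its second half [bar e1], and
    count an arrival at e1 as an arrival at e. *)
Let split_dart a := if a == bar e then bar e1 else a.
Let merge_dart a := if a == e1 then e else a.

Lemma attach_uniq : uniq v.
Proof.
apply: (count_sub_uniq u) => a.
by rewrite /v /W /attach !count_memE; bool_lia.
Qed.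

Lemma next_attach a : a \in v -> next v a = merge_dart (next W (split_dart a)).
Proof.
move=> av; pose N a := merge_dart (next W (split_dart a)).
rewrite -/(N a).
suff: lk N e (V1 ++ bar e :: V2) e by move/lk_next/(_ _ av).
move: a {av} => _.
have lW : lk (next W) e (V1 ++ bar e :: bar e1 :: V2) e1.
  have := next_lk u; rewrite -/(attach e1 k x y z w e V1 V2) -/W.
  by rewrite 11!lk_cons; do 11!case/andP=> _.
move: lW; rewrite !lkE => /and3P[l1 _ l2].
have H s : (forall a, (a == e1) + (a == bar e) + count_mem a s <= count_mem a W) ->
   {in s, forall a, N a = merge_dart (next W a)} /\ {in s, merge_dart =1 id}.
  move=> hs; have hW a : a \in s -> (a == e1) + (a == bar e) <= 0.
    rewrite mem_count => sa; have := leq_trans (hs a) (count_uniq_le a u); lia.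
  by split=> a /hW; rewrite /N /merge_dart /split_dart; do 2!case: eqP.
have h1 a : (a == e1) + (a == bar e) + count_mem a V1 <= count_mem a W.
  by rewrite /W /attach !count_memE; bool_lia.
have h2 a : (a == e1) + (a == bar e) + count_mem a V2 <= count_mem a W.
  by rewrite /W /attach !count_memE; bool_lia.
have [p1 q1] := H _ h1; have [p2 q2] := H _ h2.
apply/andP; split.
  have <- : merge_dart (bar e) = bar e.
    by rewrite /merge_dart ifN //; have := u; rewrite /W /attach => u'; occ u' e; neqs.
  apply: (lk_transport _ p1 q1 l1).
  by rewrite /N /split_dart neq_bar.
have {2}<- : merge_dart e1 = e by rewrite /merge_dart eqxx.
apply: (lk_transport _ p2 q2 l2).
by rewrite /N /split_dart eqxx.
Qed.

(** The half of the cut edge that leaves the origin of e is e1, so this matches darts of [v] and [W]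
    by origin. *)
Let unmerge a := if a == e then e1 else a.

Let ends := [:: e1; bar e1; k; bar k; x; bar x; y; bar y; z; bar z; w; bar w].

Lemma mem_attach a : (a \in W) = (a \in v) || (a \in ends).
Proof.
rewrite /W /attach /v !(inE, mem_cat).
by repeat match goal with |- context [?b == ?c] =>
  move: (b == c) => [] /=; rewrite ?orbT ?orbF //
end; move: (a \in V1) (a \in V2) => [] [].
Qed.

Lemma mem_ends a : (bar a \in ends) = (a \in ends).
Proof.
rewrite !inE !eq_bar !barK.
by repeat match goal with |- context [?b == ?c] =>
  move: (b == c) => [] /=; rewrite ?orbT ?orbF //
end.
Qed.

Lemma next_attachE : [/\ next W (bar k) = e, next W (bar e) = bar e1,
   next W e1 = k & [/\ next W (bar x) = bar w, next W w = bar k, next W k = x &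
   [/\ next W z = bar x, next W x = y, next W (bar y) = bar z &
   [/\ next W y = z, next W (bar z) = w & next W (bar w) = bar y]]]].
Proof.
have := next_lk u; rewrite -/(attach e1 k x y z w e V1 V2) -/W !lkE.
case/and5P=> /eqP-> /eqP-> /eqP-> /eqP-> /and5P[] /eqP-> /eqP-> /eqP-> /eqP->.
by case/and5P=> /eqP-> /eqP-> /eqP-> _ /andP[] /eqP-> _.
Qed.

Lemma unmerge_neq a : a \in v -> [/\ a != k, a != e1 & unmerge a != k].
Proof.
move=> av; have u' := u; rewrite /W /attach in u'.
rewrite /v in av; occ u' a.
have [n1 n2] : a != k /\ a != e1.
  split; neqs.
split=> //; rewrite /unmerge; case: ifP => // _.
by occ u' e1; neqs.
Qed.

Lemma split_bar a : split_dart (bar a) = bar (unmerge a).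
Proof. by rewrite /split_dart /unmerge bar_eq; case: ifP. Qed.

Lemma mergeK a : a != e -> unmerge (merge_dart a) = a.
Proof.
rewrite /unmerge /merge_dart => /negPf n; case: (a =P e1) => [->|_].
  by rewrite eqxx.
by rewrite n.
Qed.

Lemma unmergeK a : a != e1 -> merge_dart (unmerge a) = a.
Proof.
rewrite /unmerge /merge_dart => /negPf n; case: (a =P e) => [->|_].
  by rewrite eqxx.
by rewrite n.
Qed.

(** [unmerge] intertwines the vertex rotations of [v] and [W]. Cubicity thus passes both ways; for
    [W], four new vertices remain to be checked. *)
Lemma unmerge_next a : (forall b, b \in v -> bar b \in v) -> a \in v ->
  unmerge (next v (bar a)) = next W (bar (unmerge a)).
Proof.
move=> bv av; have [nk ne nuk] := unmerge_neq av.
rewrite next_attach ?bv // split_bar mergeK //.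
have [<- _ _ _] := next_attachE.
by rewrite (inj_eq (next_inj u)) bar_eq.
Qed.

Lemma cubic_detach : cubic W -> cubic v.
Proof.
move=> cW; have bv b : b \in v -> bar b \in v.
  move=> bv; have : bar b \in W by rewrite (mem_bar cW) mem_attach bv.
  rewrite mem_attach => /orP[] //; rewrite mem_ends => be.
  have u' := u; rewrite /W /attach in u'; rewrite /v /ends in be bv.
  by occ u' b; exfalso; suff: false by []; occs.
split=> [|//|a av]; first exact: attach_uniq.
have nv b : b \in v -> next v (bar b) \in v by move=> /bv; rewrite mem_next.
have aW : unmerge a \in W.
  by rewrite /unmerge; case: eqP => _; rewrite mem_attach ?av // !inE eqxx orbT.
have [_ _ /(_ _ aW)[r1 r3]] := cW.
split.
  by apply: contra r1 => /eqP{2}<-; rewrite unmerge_next.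
have [_ ne _] := unmerge_neq av.
rewrite -[RHS](unmergeK ne) -r3 -!unmerge_next ?nv // unmergeK //.
by have [_ ] := unmerge_neq (nv _ (nv _ (nv _ av))).
Qed.

Lemma cubic_attach : cubic v -> cubic W.
Proof.
move=> cv; have bv b : b \in v -> bar b \in v by rewrite (mem_bar cv).
split=> // [a|a aW].
  by rewrite !mem_attach mem_ends (mem_bar cv).
have nv b : b \in v -> next v (bar b) \in v by move=> /bv; rewrite mem_next.
have old b : b \in v -> a = unmerge b -> next W (bar a) != a /\
     next W (bar (next W (bar (next W (bar a))))) = a.
  move=> bv' ->; rewrite -!unmerge_next ?nv //.
  have [_ _ /(_ _ bv')[r1 ->]] := cv; split=> //.
  apply: contra r1 => /eqP E.
  have [_ n1 _] := unmerge_neq bv'; have [_ n2 _] := unmerge_neq (nv _ bv').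
  by rewrite -[X in X == _](unmergeK n2) E unmergeK.
have tri p q r : next W (bar p) = q -> next W (bar q) = r -> next W (bar r) = p ->
     p != q -> next W (bar p) != p /\
     next W (bar (next W (bar (next W (bar p))))) = p.
  by move=> E1 E2 E3 n; rewrite E1 E2 E3 eq_sym.
have u' := u; rewrite /W /attach in u'.
have [E1 E2 E3 [E4 E5 E6 [E7 E8 E9 [E10 E11 E12]]]] := next_attachE.
have [->|ane] := eqVneq a e.
  apply: (tri e (bar e1) k); rewrite ?barK //; by occ u' e; neqs.
have ev : e \in v by rewrite mem_head.
move: (aW); rewrite mem_attach => /orP[av|].
  by apply: (old a); rewrite // /unmerge (negPf ane).
rewrite !inE.
case/orP=> [/eqP ae|]; first by apply: (old e ev); rewrite /unmerge eqxx.
case/orP=> [/eqP->|].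
  apply: (tri (bar e1) k e); rewrite ?barK //; by occ u' e1; neqs.
case/orP=> [/eqP->|].
  apply: (tri k e (bar e1)); rewrite ?barK //; by occ u' k; neqs.
case/orP=> [/eqP->|].
  apply: (tri (bar k) x (bar w)); rewrite ?barK //; by occ u' k; neqs.
case/orP=> [/eqP->|].
  apply: (tri x (bar w) (bar k)); rewrite ?barK //; by occ u' x; neqs.
case/orP=> [/eqP->|].
  apply: (tri (bar x) y (bar z)); rewrite ?barK //; by occ u' x; neqs.
case/orP=> [/eqP->|].
  apply: (tri y (bar z) (bar x)); rewrite ?barK //; by occ u' y; neqs.
case/orP=> [/eqP->|].
  apply: (tri (bar y) z w); rewrite ?barK //; by occ u' y; neqs.
case/orP=> [/eqP->|].
  apply: (tri z w (bar y)); rewrite ?barK //; by occ u' z; neqs.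
case/orP=> [/eqP->|].
  apply: (tri (bar z) (bar x) y); rewrite ?barK //; by occ u' z; neqs.
case/orP=> [/eqP->|/eqP->].
  apply: (tri w (bar y) z); rewrite ?barK //; by occ u' w; neqs.
apply: (tri (bar w) (bar k) x); rewrite ?barK //; by occ u' w; neqs.
Qed.

End Attach.

(** * Normal form of the attached torus: the numbers 0 to 5 name its edges, old names move up by
    six *)

Definition shift (a : letter) : letter := (a.1 + 6, a.2).

Lemma shift_inj : injective shift.
Proof. by move=> [m b] [n c] [/addIn-> ->]. Qed.

Lemma shift_bar a : shift (bar a) = bar (shift a).
Proof. by []. Qed.

Definition upd (a b : letter) (f : letter -> letter) z :=
  if z == a then b else if z == bar a then bar b else f z.

Lemma upd_id a b f : upd a b f a = b.
Proof. by rewrite /upd eqxx. Qed.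

Lemma upd_neq a b f z : z != a -> z != bar a -> upd a b f z = f z.
Proof. by rewrite /upd => /negPf-> /negPf->. Qed.

Lemma upd_bar a b f : (forall z, f (bar z) = bar (f z)) ->
  forall z, upd a b f (bar z) = bar (upd a b f z).
Proof.
move=> fb z; rewrite /upd !eq_bar barK.
have [->|] := eqVneq z a; first by rewrite neq_bar.
by have [->|] := eqVneq z (bar a); rewrite ?barK.
Qed.

Lemma upd_inj a b f : injective f -> (forall z, b.1 != (f z).1) ->
  injective (upd a b f).
Proof.
move=> fi h; have h1 z : b != f z by apply: contra (h z) => /eqP->.
have h2 z : bar b != f z by apply: contra (h z) => /eqP <-.
have h' z : (b == f z) = false by apply/negbTE.
have h'' z : (bar b == f z) = false by apply/negbTE.
move=> y z /eqP; rewrite /upd.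
case: (y =P a) => [->|_]; case: (z =P a) => [->|_] //.
- by case: (z =P bar a) => _; rewrite ?neq_bar ?h'.
- by case: (y =P bar a) => _; rewrite ?bar_neq // eq_sym h'.
case: (y =P bar a) => [->|_]; case: (z =P bar a) => [->|_] //.
- by rewrite h''.
- by rewrite eq_sym h''.
by rewrite (inj_eq fi) => /eqP.
Qed.

Lemma upd_above i a f : (forall z, i < (f z).1) ->
  forall z, i <= (upd a (i, false) f z).1.
Proof. by move=> h z; rewrite /upd; do 2!case: ifP => //=; rewrite ltnW. Qed.

(** Giving one edge a number below all values of [f] preserves injectivity. Iterated from 5 down to
    0, this builds the renaming of [attach_ins]. *)
Lemma relabelling i a f : 
  [/\ injective f, forall z, f (bar z) = bar (f z) & forall z, i < (f z).1] ->
  let g := upd a (i, false) f in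
  [/\ injective g, forall z, g (bar z) = bar (g z) & forall z, i <= (g z).1].
Proof.
move=> [fi fb fa] g; split; [|exact: upd_bar|exact: upd_above].
by apply: upd_inj => // z; rewrite neq_ltn fa.
Qed.

Definition lett i : letter := (i, false).

Definition ins e V1 V2 := attach (lett 0) (lett 1) (lett 2) (lett 3) (lett 4)
  (lett 5) (shift e) (map shift V1) (map shift V2).

Lemma attach_ins e1 k x y z w e V1 V2 :
  cubic (attach e1 k x y z w e V1 V2) ->
  eqv (attach e1 k x y z w e V1 V2) (ins e V1 V2).
Proof.
move=> c; have u := cubic_uniq c.
have p6 : [/\ injective shift, forall z, shift (bar z) = bar (shift z) &
   forall z, 5 < (shift z).1].
  by split; [exact: shift_inj | exact: shift_bar | move=> a; rewrite /= addnC].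
set f5 := upd w (lett 5) shift.
have p5 := relabelling w p6.
set f4 := upd z (lett 4) f5.
have p4 : [/\ injective f4, forall z, f4 (bar z) = bar (f4 z) & forall z, 3 < (f4 z).1].
  exact: relabelling.
set f3 := upd y (lett 3) f4.
have p3 : [/\ injective f3, forall z, f3 (bar z) = bar (f3 z) & forall z, 2 < (f3 z).1].
  exact: relabelling.
set f2 := upd x (lett 2) f3.
have p2 : [/\ injective f2, forall z, f2 (bar z) = bar (f2 z) & forall z, 1 < (f2 z).1].
  exact: relabelling.
set f1 := upd k (lett 1) f2.
have p1 : [/\ injective f1, forall z, f1 (bar z) = bar (f1 z) & forall z, 0 < (f1 z).1].
  exact: relabelling.
pose f := upd e1 (lett 0) f1.
have [fi fb _] : [/\ injective f, forall z, f (bar z) = bar (f z)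
   & forall z, 0 <= (f z).1].
  exact: relabelling.
suff <- : map f (attach e1 k x y z w e V1 V2) = ins e V1 V2.
  exact: eqv_map.
rewrite /attach in u.
have fe1 : f e1 = lett 0 by apply: upd_id.
have fk : f k = lett 1.
  by rewrite /f upd_neq /f1 ?upd_id //; occ u k; neqs.
have fx : f x = lett 2.
  by rewrite /f upd_neq /f1 1?upd_neq /f2 ?upd_id //; occ u x; neqs.
have fy : f y = lett 3.
  by rewrite /f upd_neq /f1 1?upd_neq /f2 1?upd_neq /f3 ?upd_id //; occ u y; neqs.
have fz : f z = lett 4.
  by rewrite /f upd_neq /f1 1?upd_neq /f2 1?upd_neq /f3 1?upd_neq /f4 ?upd_id //;
    occ u z; neqs.
have fw : f w = lett 5.
  by rewrite /f upd_neq /f1 1?upd_neq /f2 1?upd_neq /f3 1?upd_neq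
    /f4 1?upd_neq /f5 ?upd_id //; occ u w; neqs.
have fo v : v \in e :: V1 ++ V2 -> f v = shift v.
  move=> vV.
  by rewrite /f upd_neq /f1 1?upd_neq /f2 1?upd_neq /f3 1?upd_neq
    /f4 1?upd_neq /f5 1?upd_neq //; occ u v; neqs.
have fV1 : map f V1 = map shift V1.
  by apply/eq_in_map => v vV; apply: fo; rewrite inE mem_cat vV orbT.
have fV2 : map f V2 = map shift V2.
  by apply/eq_in_map => v vV; apply: fo; rewrite inE mem_cat vV !orbT.
by rewrite /attach /= map_cat /= !fb fe1 fk fx fy fz fw fo ?mem_head // fV1 fV2.
Qed.

Lemma ins_uniq e V1 V2 : uniq (e :: V1 ++ bar e :: V2) -> uniq (ins e V1 V2).
Proof.
move=> u; pose n12 := [:: lett 0; lett 1; lett 2; lett 3; lett 4; lett 5;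
  bar (lett 0); bar (lett 1); bar (lett 2); bar (lett 3); bar (lett 4); bar (lett 5)].
have u12 : uniq (n12 ++ map shift (e :: V1 ++ bar e :: V2)).
  rewrite cat_uniq map_inj_uniq ?u ?andbT; last exact: shift_inj.
  apply/hasPn => _ /mapP[a _ ->].
  have : all (fun z : letter => z.1 < 6) n12 by [].
  by move/allP/(_ (shift a)) => h; apply/negP => /h; rewrite /= ltnNge leq_addl.
apply: (count_sub_uniq u12) => a.
by rewrite /n12 /ins /attach map_cons map_cat map_cons shift_bar !count_memE; bool_lia.
Qed.

Lemma cubic_ins e V1 V2 : cubic (e :: V1 ++ bar e :: V2) -> cubic (ins e V1 V2).
Proof.
move=> c; apply: cubic_attach; first exact/ins_uniq/cubic_uniq.
by have := cubic_map c shift_inj shift_bar; rewrite map_cons map_cat map_cons shift_bar.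
Qed.

(* The torus is attached in front of the first letter of w.                   *)
Definition insw (w : seq letter) :=
  if w is e :: V then
    let i := index (bar e) V in ins e (take i V) (drop i.+1 V)
  else [::].

Lemma insw_split e V1 V2 : uniq (e :: V1 ++ bar e :: V2) ->
  insw (e :: V1 ++ bar e :: V2) = ins e V1 V2.
Proof.
move=> u; have n1 : bar e \notin V1 by occ u (bar e); occs.
rewrite /insw index_cat (negPf n1) /= eqxx addn0.
by rewrite take_size_cat // drop_cat ltnNge leqnSn /= subSnn /= drop0.
Qed.

Lemma cubic_split w : cubic w -> w <> [::] ->
  exists e V1 V2, w = e :: V1 ++ bar e :: V2.
Proof.
case: w => // e V c _; have := mem_head e V; rewrite -(mem_bar c) inE bar_neq /=.
by case/splitPr => V1 V2; exists e, V1, V2.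
Qed.

Lemma cubic_insw w : cubic w -> w <> [::] -> cubic (insw w).
Proof.
move=> c /(cubic_split c)[e [V1 [V2 E]]]; rewrite E in c *.
by rewrite insw_split ?cubic_uniq //; apply: cubic_ins.
Qed.

Lemma size_insw w : cubic w -> w <> [::] -> size (insw w) = size w + 12.
Proof.
move=> c /(cubic_split c)[e [V1 [V2 E]]]; rewrite E in c *.
rewrite insw_split ?cubic_uniq // /ins /attach /= !size_cat /= !size_map; lia.
Qed.

Lemma insw_map f w : cubic w -> w <> [::] -> injective f ->
  (forall x, f (bar x) = bar (f x)) -> eqv (insw w) (insw (map f w)).
Proof.
move=> c wn fi fb; have ci := cubic_insw c wn.
have [e [V1 [V2 E]]] := cubic_split c wn; have c' := cubic_map c fi fb.
pose g (z : letter) : letter := if z.1 < 6 then z else shift (f (z.1 - 6, z.2)).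
have gs z : g (shift z) = shift (f z).
  by rewrite /g /= ltnNge leq_addl /= addnK; case: z.
have gl z : z.1 < 6 -> g z = z by rewrite /g => ->.
have gi : injective g.
  have sh (z : letter) : ~~ (z.1 < 6) -> z = shift (z.1 - 6, z.2).
    by case: z => m b /=; rewrite -leqNgt /shift /= => h; rewrite subnK.
  move=> y z; have [y6|/sh->] := boolP (y.1 < 6); have [z6|/sh->] := boolP (z.1 < 6).
  - by rewrite !gl.
  - by rewrite gl // gs => E'; move: y6; rewrite E' /= ltnNge leq_addl.
  - by rewrite gs gl // => E'; move: z6; rewrite -E' /= ltnNge leq_addl.
  - by rewrite !gs => /shift_inj/fi->.
have gb z : g (bar z) = bar (g z).
  by rewrite /g /=; case: ifP => // _; rewrite -shift_bar -fb.
suff -> : insw (map f w) = map g (insw w) by apply: eqv_map.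
rewrite E in c c' ci *; rewrite insw_split ?cubic_uniq //.
rewrite map_cons map_cat map_cons fb in c' *.
rewrite insw_split ?cubic_uniq // /ins /attach !map_cons !map_cat !map_cons.
rewrite !gb !gs !gl // -!map_comp.
by congr [:: _, _, _, _, _, _, _, _, _, _, _, _ & _ ++ [:: _, _ & _]];
  apply: eq_map => z /=; rewrite gs.
Qed.

(** The half-edge [lett 0] replaces x in the surgery: the torus and the other half of x lie inside
    the first arc, which the surgery leaves in place. *)
Lemma insw_step x A B y C D :
  let w := x :: A ++ bar x :: B ++ y :: C ++ bar y :: D in
  let w' := x :: A ++ bar x :: D ++ y :: C ++ bar y :: B in
  cubic w -> eqv (insw w) (insw w').
Proof.
move=> w w' c; have c' := cubic_step c; have ci : cubic (insw w) by apply: cubic_insw.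
move: ci; rewrite !insw_split ?cubic_uniq // /ins /attach.
set T := lett 1; set e1 := lett 0.
rewrite !(map_cat, map_cons) !shift_bar => ci.
have := @eqv_step e1 [:: T, lett 2, lett 3, lett 4, bar (lett 2), bar (lett 5),
  bar (lett 3), bar (lett 4), lett 5, bar T, shift x & map shift A ++
  [:: bar (shift x)]] (map shift B) (shift y) (map shift C) (map shift D).
by rewrite !catE; apply.
Qed.

(** * Sliding the torus along the face *)

Definition swap_darts a b z :=
  if z == a then b else if z == b then a else
  if z == bar a then bar b else if z == bar b then bar a else z.

Section SwapDarts.
Variables a b : letter.
Hypotheses (ab : a != b) (abb : a != bar b).

Let f := swap_darts a b.

Lemma swap_dartsE : [/\ f a = b, f b = a, f (bar a) = bar b, f (bar b) = bar a
  & forall z, z != a -> z != b -> z != bar a -> z != bar b -> f z = z].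
Proof.
have n1 := negPf ab; have n2 := negPf abb.
have n3 : (b == a) = false by rewrite eq_sym.
have n4 : (b == bar a) = false by rewrite eq_sym eq_bar.
rewrite /f /swap_darts ?eq_barE ?n1 ?n2 ?n3 ?n4; split=> //.
by move=> z /negPf-> /negPf-> /negPf-> /negPf->.
Qed.

Lemma swap_darts_ind (P : letter -> Prop) :
  P a -> P b -> P (bar a) -> P (bar b) ->
  (forall z, z != a -> z != b -> z != bar a -> z != bar b -> P z) ->
  forall z, P z.
Proof.
move=> Pa Pb Pba Pbb Pz z.
have [->//|za] := eqVneq z a; have [->//|zb] := eqVneq z b.
have [->//|zba] := eqVneq z (bar a); have [->//|zbb] := eqVneq z (bar b).
exact: Pz.
Qed.

Lemma swap_dartsK : involutive f.
Proof.
have [fa fb fba fbb fz] := swap_dartsE.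
by apply: swap_darts_ind => *; rewrite ?fa ?fb ?fba ?fbb ?fa ?fb ?fba ?fbb //;
  do !rewrite fz.
Qed.

Lemma swap_darts_bar z : f (bar z) = bar (f z).
Proof.
have [fa fb fba fbb fz] := swap_dartsE.
elim/swap_darts_ind: z => [||||z za zb zba zbb]; rewrite ?barK ?fa ?fb ?fba ?fbb ?barK //.
by rewrite !fz // ?bar_eq // ?eq_bar // barK.
Qed.

End SwapDarts.

(* The surgery on the bridge and y moves y onto the edge e, in exchange for   *)
(* the torus; renaming the pieces of e, the torus has moved from e to h.      *)
Lemma slide e y h C D :
  cubic (e :: y :: C ++ bar y :: h :: D) ->
  eqv (insw (e :: y :: C ++ bar y :: h :: D))
      (insw (h :: D ++ e :: y :: C ++ [:: bar y])).
Proof.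
set w := e :: _ => c; have u := cubic_uniq c; have l := next_lk u.
rewrite !lkE -/w in l; case/and4P: l => /eqP Ey lC /eqP Eh lD.
have ew : e \in w by apply: mem_head.
have yw : bar y \in w by rewrite /w; count_mems; bool_lia.
have hw : h \in w by rewrite /w; count_mems; bool_lia.
have Ebh := cubic_vertex c ew Ey Eh.
have hbe : h != bar e.
  apply/eqP => E; have := cubic_next_bar c ew; move: Ebh; rewrite E barK => ->.
  by rewrite eqxx.
have hby : h != bar y by rewrite -Eh cubic_next_neq.
have hy : h != y by rewrite -Eh -[X in _ != X]barK cubic_next_bar.
have hCD : (bar h \in C) || (bar h \in D).
  have : bar h \in w by rewrite (mem_bar c).
  rewrite /w !(inE, mem_cat) !eq_bar !barK.
  by rewrite (negPf hbe) (negPf hby) (negPf hy) neq_bar /= ?orbF.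
pose f := swap_darts (shift e) (lett 0).
have se1 : shift e != lett 0 by rewrite xpair_eqE /= addnC.
have se2 : shift e != bar (lett 0) by rewrite xpair_eqE /= addnC.
have [fa fb fba fbb fz] := swap_dartsE se1 se2.
have fi := inv_inj (swap_dartsK se1 se2).
have fbar := swap_darts_bar se1 se2.
rewrite -/f in fa fb fba fbb fz fi fbar.
have fl i : 0 < i < 6 -> f (lett i) = lett i.
  case/andP=> i0 i6; apply: fz; rewrite xpair_eqE /= ?negb_and.
  - by rewrite neq_ltn (leq_trans i6) ?leq_addl.
  - by rewrite -lt0n i0.
  - by rewrite neq_ltn (leq_trans i6) ?leq_addl.
  - by rewrite -lt0n i0.
have fs v : v != e -> v != bar e -> f (shift v) = shift v.
  move=> ve vbe; apply: fz; rewrite ?(inj_eq shift_inj) //.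
  - by rewrite xpair_eqE /= addnC.
  - by rewrite -shift_bar (inj_eq shift_inj).
  - by rewrite xpair_eqE /= addnC.
have fm X : (forall a, (a == e) + (a == bar e) + count_mem a X <= count_mem a w) ->
    map f (map shift X) = map shift X.
  move=> hX; rewrite -map_comp; apply/eq_in_map => v vX /=.
  rewrite mem_count in vX.
  have h2 := leq_trans (hX v) (count_uniq_le v u).
  by apply: fs; neqs.
have ci : cubic (insw w) by apply: cubic_insw.
pose T := [:: lett 2; lett 3; lett 4; bar (lett 2); bar (lett 5);
  bar (lett 3); bar (lett 4); lett 5].
have core M N W : W = lett 0 :: lett 1 :: T ++ bar (lett 1) :: shift e :: shift y ::
      M ++ bar (shift y) :: N -> cubic W ->
    eqv W (map f (shift e :: lett 1 :: T ++ bar (lett 1) :: N ++ lett 0 ::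
      shift y :: M ++ [:: bar (shift y)])).
  move=> -> c0; have c1 := cubic_catC (u := [:: lett 0]) c0; rewrite !catE in c1.
  apply: EqvTrans (eqv_catC (u := [:: lett 0]) c0) _; rewrite !catE.
  have := @eqv_step (lett 1) T [:: shift e] (shift y) M (N ++ [:: lett 0]).
  have := @cubic_step (lett 1) (shift y) T [:: shift e] M (N ++ [:: lett 0]).
  rewrite !catE => /(_ c1) c2 /(_ c1) st; apply: EqvTrans st _.
  set X := lett 1 :: T ++ bar (lett 1) :: N ++ lett 0 :: shift y :: M ++
    [:: bar (shift y)].
  have EX : lett 1 :: T ++ bar (lett 1) :: N ++ lett 0 :: shift y :: M ++
    [:: bar (shift y); shift e] = X ++ [:: shift e] by rewrite /X !catE.
  rewrite EX in c2 *; apply: EqvTrans (eqv_catC c2) _.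
  exact: eqv_map (cubic_catC c2) fi fbar.
have fsm v : (forall a, (a == e) + (a == bar e) + (a == v) <= count_mem a w) ->
    f (shift v) = shift v.
  by move=> hv; have [] : map f (map shift [:: v]) = map shift [:: v] by
    apply: fm => a; rewrite /= addn0 [v == a]eq_sym.
(* [bar h] precedes or follows [bar y]; [core] serves both cases. Exchanging the two halves of e
   turns [bar h], [bar e], [bar (lett 0)] into [bar h], [bar (lett 0)], [bar e], as for a torus
   sitting on h. *)
case/orP: hCD => hX.
  have [|C1 [C2 E]] := lk_split lC hX Ebh.
    by rewrite bar_eq; apply/eqP=> E; have := cubic_next_neq c ew; rewrite Ey E eqxx.
  have Ew : w = e :: (y :: C1 ++ [:: bar h]) ++ bar e :: (C2 ++ bar y :: h :: D).
    by rewrite /w E !catE.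
  have -> : h :: D ++ e :: y :: C ++ [:: bar y] =
     h :: (D ++ e :: y :: C1) ++ bar h :: (bar e :: C2 ++ [:: bar y]).
    by rewrite E !catE.
  have cnt a : count_mem a w = (a == e) + (a == bar e) + (a == y) + (a == bar y)
      + (a == h) + (a == bar h) + count_mem a C1 + count_mem a C2 + count_mem a D.
    by rewrite Ew !count_memE /=; bool_lia.
  rewrite Ew insw_split -?Ew // in ci *; rewrite insw_split; last first.
    by apply: (count_sub_uniq u) => a; rewrite cnt !count_memE /=; bool_lia.
  have fC1 : map f (map shift C1) = map shift C1.
    by apply: fm => a; rewrite cnt; bool_lia.
  have fC2 : map f (map shift C2) = map shift C2.
    by apply: fm => a; rewrite cnt; bool_lia.
  have fD : map f (map shift D) = map shift D.
    by apply: fm => a; rewrite cnt; bool_lia.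
  have fy : f (shift y) = shift y by apply: fsm => a; rewrite cnt; bool_lia.
  have fh : f (shift h) = shift h by apply: fsm => a; rewrite cnt; bool_lia.
  have := core (map shift C1 ++ bar (shift h) :: bar (shift e) :: bar (lett 0)
    :: map shift C2) (shift h :: map shift D) _ _ ci.
  rewrite /T !(map_cons, map_cat) !fbar fC1 fC2 fD fa fb fy fh !fl //.
  rewrite /ins /attach !(map_cons, map_cat) !shift_bar !catE; apply.
  by rewrite /= ?catE.
have [|D1 [D2 E]] := lk_split lD hX Ebh; first by rewrite bar_neq.
have Ew : w = e :: (y :: C ++ bar y :: h :: D1 ++ [:: bar h]) ++ bar e :: D2.
  by rewrite /w E !catE.
have -> : h :: D ++ e :: y :: C ++ [:: bar y] =
   h :: D1 ++ bar h :: (bar e :: D2 ++ e :: y :: C ++ [:: bar y]).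
  by rewrite E !catE.
have cnt a : count_mem a w = (a == e) + (a == bar e) + (a == y) + (a == bar y)
    + (a == h) + (a == bar h) + count_mem a C + count_mem a D1 + count_mem a D2.
  by rewrite Ew !count_memE /=; bool_lia.
rewrite Ew insw_split -?Ew // in ci *; rewrite insw_split; last first.
  by apply: (count_sub_uniq u) => a; rewrite cnt !count_memE /=; bool_lia.
have fC : map f (map shift C) = map shift C.
  by apply: fm => a; rewrite cnt; bool_lia.
have fD1 : map f (map shift D1) = map shift D1.
  by apply: fm => a; rewrite cnt; bool_lia.
have fD2 : map f (map shift D2) = map shift D2.
  by apply: fm => a; rewrite cnt; bool_lia.
have fy : f (shift y) = shift y by apply: fsm => a; rewrite cnt; bool_lia.
have fh : f (shift h) = shift h by apply: fsm => a; rewrite cnt; bool_lia.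
have := core (map shift C) (shift h :: map shift D1 ++ bar (shift h) ::
  bar (shift e) :: bar (lett 0) :: map shift D2) _ _ ci.
rewrite /T !(map_cons, map_cat) !fbar fC fD1 fD2 fa fb fy fh !fl //.
rewrite /ins /attach !(map_cons, map_cat) !shift_bar !catE; apply.
by rewrite /= ?catE.
Qed.

Lemma lk_det (T : eqType) (N : T -> T) x p q a b :
  lk N x p a -> lk N x q b -> size p = size q -> p = q.
Proof.
elim: p q x => [|c p IH] [|d q] x //; rewrite !lkE.
by case/andP=> /eqP<- lp /andP[/eqP E lq] [/(IH _ _ lp)->] //; rewrite E.
Qed.

Definition insw_at w e := insw (rot (index e w) w).

Lemma insw_atE i w e V : uniq w -> rot i w = e :: V -> insw_at w e = insw (e :: V).
Proof.
move=> u E; have ew : e \in w by rewrite -(mem_rot i) E mem_head.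
have := rot_index ew; rewrite /insw_at /= => E'; rewrite E'; congr (insw (_ :: _)).
have lr j s : rot j w = e :: s -> lk (next w) e s e.
  move=> Ej; have u' : uniq (e :: s) by rewrite -Ej rot_uniq.
  have := next_lk u'; rewrite -Ej /lk; under eq_path do rewrite /frel /= (next_rot _ u).
  done.
apply: lk_det (lr _ _ E') (lr _ _ E) _.
by have := congr1 size E'; rewrite size_rot -(size_rot i) E => -[].
Qed.

(** One slide past the vertex at the head of [a]. Phrased with reversed letters, it becomes a step
    of [next] and can be iterated around the face. *)
Lemma insw_at_next w a : cubic w -> a \in w ->
  eqv (insw_at w (bar (next w a))) (insw_at w (bar a)).
Proof.
move=> c aw; set e := bar (next w a); set h := bar a.
have ew : e \in w by rewrite (mem_bar c) mem_next.
have := rot_index ew; set V := drop _ _ ++ _ => /= E.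
have u := cubic_uniq c; rewrite (insw_atE u E).
have c' : cubic (e :: V) by rewrite -E; apply: cubic_rot.
have nE : next (e :: V) =1 next w by rewrite -E; apply: next_rot.
have u' := cubic_uniq c'; have l := next_lk u'.
have aw' : a \in e :: V by rewrite -E mem_rot.
case: V E c' nE u' l aw' => [|y V] E c' nE u' l aw'.
  by move: (mem_bar c' e); rewrite mem_head inE bar_neq.
rewrite lkE in l; case/andP: l => /eqP Ey lV.
have ew' := mem_head e (y :: V).
have ye : y != bar e by rewrite -Ey cubic_next_bar.
have Eh : next (e :: y :: V) (bar y) = h.
  have Ea : next (e :: y :: V) a = bar e by rewrite nE /e barK.
  by apply: (cubic_vertex c' aw' Ea); rewrite barK.
have yV : bar y \in V.
  have : bar y \in [:: e, y & V] by rewrite (mem_bar c') !inE eqxx orbT.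
  by rewrite !inE bar_neq eq_bar (negPf ye).
have he : h != e.
  apply/eqP=> he; have := cubic_next_neq c aw.
  by rewrite -[next w a]barK -/e -he /h barK eqxx.
have [C [D EV]] := lk_split lV yV Eh he.
rewrite EV in E c' *; apply: EqvTrans (slide c') _.
have Eh' : rot (size (e :: y :: C ++ [:: bar y])) (e :: y :: C ++ bar y :: h :: D)
   = h :: (D ++ e :: y :: C ++ [:: bar y]).
  have -> : e :: y :: C ++ bar y :: h :: D = (e :: y :: C ++ [:: bar y]) ++ h :: D.
    by rewrite !catE.
  exact: rot_size_cat.
have E2 := rot_rot_add (index e w) (size (e :: y :: C ++ [:: bar y])) w.
rewrite E Eh' in E2; rewrite -(insw_atE u (esym E2)) -/h.
exact: EqvRefl.
Qed.

Lemma lk_connect (T : eqType) (N : T -> T) (R : T -> T -> Prop) x s b :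
    lk N x s b -> (forall a, R a a) -> (forall a b c, R a b -> R b c -> R a c) ->
    {in x :: s, forall a, R (N a) a} -> {in s, forall a, R a x}.
Proof.
move=> l Rr Rt; elim: s x l => // c s IH x; rewrite lkE => /andP[/eqP E l] h.
have Rcx : R c x by rewrite -E; apply: h; apply: mem_head.
move=> a; rewrite inE => /predU1P[->//|as_].
apply: (Rt _ c) => //; apply: IH l _ _ as_ => v vs.
by apply: h; rewrite inE vs orbT.
Qed.

Lemma insw_at_eqv w a b : cubic w -> a \in w -> b \in w ->
  eqv (insw_at w a) (insw_at w b).
Proof.
move=> c aw bw; case: w c aw bw => // x s c aw bw; set w := x :: s in c aw bw *.
have u := cubic_uniq c; have l := next_lk u.
have H v : v \in w -> eqv (insw_at w (bar v)) (insw_at w (bar x)).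
  rewrite inE => /predU1P[->|vs]; first exact: EqvRefl.
  apply: (lk_connect (R := fun a b => eqv (insw_at w (bar a)) (insw_at w (bar b))) l) vs.
  - by move=> *; apply: EqvRefl.
  - by move=> a' b' c'; apply: EqvTrans.
  - by move=> a' a'w; apply: insw_at_next.
have {}H v : v \in w -> eqv (insw_at w v) (insw_at w (bar x)).
  by move=> vw; rewrite -[v in insw_at _ v]barK; apply: H; rewrite (mem_bar c).
exact: EqvTrans (H _ aw) (EqvSym (H _ bw)).
Qed.

Lemma insw_move w w' : cubic w -> move w w' -> eqv (insw w) (insw w').
Proof.
move=> c m; case: m c => [n {}w|f {}w fi fb|x A B y C D] c.
- case: w c => [|e V] c; first exact: EqvRefl.
  have u := cubic_uniq c; case E : (rot n (e :: V)) => [|h V'].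
    by have := size_rot n (e :: V); rewrite E.
  rewrite -(insw_atE u (rot0 _)) -(insw_atE u E).
  apply: insw_at_eqv => //; first exact: mem_head.
  by rewrite -(mem_rot n) E mem_head.
- case: (w =P [::]) => [->|wn]; first exact: EqvRefl.
  exact: insw_map.
exact: insw_step.
Qed.

Lemma insw_eqv w w' : eqv w w' -> eqv (insw w) (insw w').
Proof.
elim=> [v v' c m|v|v v' _ h|v1 v2 v3 _ h1 _ h2].
- exact: insw_move.
- exact: EqvRefl.
- exact: EqvSym.
- exact: EqvTrans h1 h2.
Qed.

(** * Classification of cubic words by their length *)

Definition theta := [:: lett 0; lett 1; lett 2; bar (lett 0); bar (lett 1); bar (lett 2)].

Lemma theta_eqv x y z : cubic [:: x; y; z; bar x; bar y; bar z] ->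
  eqv [:: x; y; z; bar x; bar y; bar z] theta.
Proof.
move=> c; have u := cubic_uniq c.
have p3 : [/\ injective shift, forall z, shift (bar z) = bar (shift z) &
   forall z, 2 < (shift z).1].
  by split; [exact: shift_inj|exact: shift_bar|move=> a; rewrite /= addnC].
set f2 := upd z (lett 2) shift.
have p2 : [/\ injective f2, forall z, f2 (bar z) = bar (f2 z) & forall z, 1 < (f2 z).1].
  exact: relabelling.
set f1 := upd y (lett 1) f2.
have p1 : [/\ injective f1, forall z, f1 (bar z) = bar (f1 z) & forall z, 0 < (f1 z).1].
  exact: relabelling.
pose f := upd x (lett 0) f1.
have [fi fb _] : [/\ injective f, forall z, f (bar z) = bar (f z)
   & forall z, 0 <= (f z).1].
  exact: relabelling.
suff <- : map f [:: x; y; z; bar x; bar y; bar z] = theta by apply: eqv_map.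
have fx : f x = lett 0 by apply: upd_id.
have fy : f y = lett 1.
  by rewrite /f upd_neq /f1 ?upd_id //; occ u y; neqs.
have fz : f z = lett 2.
  by rewrite /f upd_neq /f1 1?upd_neq /f2 ?upd_id //; occ u z; neqs.
by rewrite /= !fb fx fy fz.
Qed.

Lemma cubic_reduce w : cubic w -> w <> [::] -> eqv w theta \/
  exists v, [/\ cubic v, v <> [::] & eqv w (insw v)].
Proof.
case: w => // a s c _; have cr := cubic_crossing c.
have [p [b [d [U [V [W e1]]]]]] := cr.
have c1 := (eqv_cubic e1).1 c.
have [x [y [z [R e2]]]] := crossing_digon (ltnSn (size V)) c1.
have c2 := (eqv_cubic e2).1 c1; have {e1}e2 := EqvTrans e1 e2.
have [ER|[w [B [C ER]]]] := digon_shape c2; rewrite ER in c2 e2.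
  by left; apply: EqvTrans e2 (theta_eqv c2).
have [x' [y' [z' [w' [C' e3]]]]] := digon_pendant c2.
have c3 := (eqv_cubic e3).1 c2; have {e2}e3 := EqvTrans e2 e3.
have [k [e [e1 [V1 [V2 EC]]]]] := pendant_shape c3; rewrite EC in c3 e3.
set X := [:: x', y', z', bar x', bar w', bar y', bar z', w', bar k,
  e & V1 ++ bar e :: bar e1 :: V2].
have EX : [:: x', y', z', bar x', bar w', bar y', bar z', w', bar k,
  e & V1 ++ [:: bar e, bar e1 & V2 ++ [:: e1; k]]] = X ++ [:: e1; k].
  by rewrite /X !catE.
rewrite EX in c3 e3; have e4 := eqv_catC c3.
have c4 := cubic_catC c3.
right; exists (e :: V1 ++ bar e :: V2).
have c5 : cubic (e :: V1 ++ bar e :: V2) by exact: (cubic_detach (cubic_uniq c4) c4).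
split=> //; rewrite insw_split ?cubic_uniq //.
exact: EqvTrans e3 (EqvTrans e4 (attach_ins c4)).
Qed.

(** The two outcomes of [cubic_reduce] cannot mix: [theta] has six letters, a word with an attached
    torus more than twelve. *)
Lemma cubic_eqv w w' : cubic w -> cubic w' -> size w = size w' -> eqv w w'.
Proof.
have [n] := ubnP (size w); elim: n w w' => // n IH w w' wn c c' E.
case: (w =P [::]) => [w0|w0].
  by move: E; rewrite w0 => /esym/size0nil->; apply: EqvRefl.
case: (w' =P [::]) => [w'0|w'0].
  by move: E; rewrite w'0 => /size0nil.
have H v : cubic v -> v <> [::] -> 0 < size v by case: v.
have [e|[v [cv v0 e]]] := cubic_reduce c w0;
  have [e'|[v' [cv' v'0 e']]] := cubic_reduce c' w'0.
- exact: EqvTrans e (EqvSym e').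
- by have := eqv_size e; have := eqv_size e'; rewrite size_insw //= -E => -> ; lia.
- by have := eqv_size e; have := eqv_size e'; rewrite size_insw //= -E => -> ; lia.
have Ev := eqv_size e; have Ev' := eqv_size e'; rewrite !size_insw // in Ev Ev'.
apply: EqvTrans e _; apply: EqvTrans (EqvSym e'); apply: insw_eqv.
apply: IH => //; lia.
Qed.

Lemma cubic_theta : cubic theta.
Proof.
have ai (P : letter -> Prop) : P (lett 0) -> P (lett 1) -> P (lett 2) ->
    P (bar (lett 0)) -> P (bar (lett 1)) -> P (bar (lett 2)) -> {in theta, forall x, P x}.
  move=> *; move=> x; rewrite !inE.
  by do 5![case/orP=> [/eqP->//|]]; move/eqP->.
split=> //; first exact: ai.
exact: ai.
Qed.

Lemma cubic_exists g : exists2 w, cubic w & size w = 12 * g + 6.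
Proof.
elim: g => [|g [w c E]]; first by exists theta => //; apply: cubic_theta.
have wn : w <> [::] by case: w E {c} => //; rewrite addnC.
exists (insw w); first exact: cubic_insw.
by rewrite size_insw // E; lia.
Qed.

(** * From words to rotation systems *)

Section PermutationCycles.
Variable T : finType.
Implicit Types (s : {perm T}) (x y : T).

Lemma porbit_fconnect s x y : (y \in porbit s x) = fconnect s x y.
Proof.
apply/porbitP/idP => [[i ->]|h]; first by rewrite permX fconnect_iter.
by exists (findex s x y); rewrite permX iter_findex.
Qed.

Lemma card_porbit_cycle s x p :
  fcycle s p -> uniq p -> x \in p -> #|porbit s x| = size p.
Proof.
move=> c u xp; rewrite -(card_uniqP u); apply: eq_card => y.
by rewrite porbit_fconnect (fconnect_cycle c xp).
Qed.

Lemma card_porbits_uniform s k :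
  (forall x, #|porbit s x| = k) -> #|T| = #|porbits s| * k.
Proof.
move=> h; rewrite -cardsT; apply: card_uniform_partition.
  by move=> _ /imsetP[x _ ->].
have -> : porbits s = preim_partition (porbit s) [set: T].
  have E x : porbit s x = [set y in [set: T] | porbit s x == porbit s y].
    by apply/setP => y; rewrite !inE eq_porbit_mem porbit_sym.
  by apply/setP => A; apply/imsetP/imsetP => -[x _ ->]; exists x; rewrite ?inE // -E.
exact: preim_partitionP.
Qed.

Lemma card_porbit3 s x : s x != x -> s (s (s x)) = x -> #|porbit s x| = 3.
Proof.
move=> n E; rewrite (@card_porbit_cycle s x [:: x; s x; s (s x)]) ?mem_head //=.
  by rewrite !eqxx E eqxx.
rewrite !inE negb_or [x == s x]eq_sym n /= andbT [s x == _]eq_sym (inj_eq perm_inj) n.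
by rewrite andbT; apply: contra n => /eqP{1}->; rewrite E.
Qed.

Lemma card_porbit2 s x : s x != x -> s (s x) = x -> #|porbit s x| = 2.
Proof.
move=> n E; rewrite (@card_porbit_cycle s x [:: x; s x]) ?mem_head //=.
  by rewrite E !eqxx.
by rewrite inE eq_sym n.
Qed.

End PermutationCycles.

Lemma subseq_map_inj (T T' : eqType) (f : T -> T') s1 s2 : injective f ->
  subseq (map f s1) (map f s2) -> subseq s1 s2.
Proof.
move=> fi; elim: s2 s1 => [|y s2 IH] [|x s1] //=; rewrite (inj_eq fi).
by case: eqP => _; [apply: IH|apply: (IH (x :: s1))].
Qed.

(** * Rotation systems and their boundary words *)

Section Representation.
Variable D : finType.
Implicit Types (m : rotsys D) (w : seq letter) (phi : D -> letter).

(** [edge] and [face] determine the vertex rotation ([represents_vrot]), and surjectivity onto [w]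
    comes from counting ([represents_onto]). *)
Definition represents w m phi :=
  [/\ injective phi, forall d, phi d \in w,
      forall d, phi (edge m d) = bar (phi d)
    & forall d, phi (face m d) = next w (phi d)].

Lemma represents_edgeK w m phi d : represents w m phi -> edge m (edge m d) = d.
Proof. by case=> fi _ fe _; apply: fi; rewrite !fe barK. Qed.

Lemma represents_vrot w m phi d :
  represents w m phi -> phi (vrot m d) = next w (bar (phi d)).
Proof.
move=> r; have [_ _ fe ff] := r.
by rewrite -fe -ff faceE (represents_edgeK _ r).
Qed.

Lemma represents_onto w m phi a : represents w m phi -> uniq w ->
  size w = #|D| -> a \in w -> exists d, phi d = a.
Proof.
case=> fi fw _ _ u sw aw.
have uc : uniq (map phi (enum D)) by rewrite map_inj_uniq ?enum_uniq.
have sub : {subset map phi (enum D) <= w} by move=> _ /mapP[d _ ->].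
have sz : size w <= size (map phi (enum D)) by rewrite size_map -cardE sw.
have [_ eqi] := uniq_min_size uc sub sz.
by move: aw; rewrite -eqi => /mapP[d _ ->]; exists d.
Qed.

Lemma lift_word w phi : {in w, forall a, exists d, phi d = a} ->
  exists p, map phi p = w.
Proof.
elim: w => [|a w IH] h; first by exists [::].
have [d <-] := h a (mem_head _ _).
have [|p <-] := IH; last by exists (d :: p).
by move=> b bw; apply: h; rewrite inE bw orbT.
Qed.

Lemma represents_cycle w m phi p : represents w m phi -> uniq w ->
  map phi p = w -> fcycle (face m) p /\ uniq p.
Proof.
move=> [fi _ _ ff] u E; split; last by rewrite -(map_inj_uniq fi) E.
have := cycle_next u; rewrite -{2}E cycle_map; apply: sub_cycle => x y /=.
by rewrite -ff (inj_eq fi).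
Qed.

Lemma represents_iso w m m' phi phi' : uniq w -> size w = #|D| ->
  represents w m phi -> represents w m' phi' -> rotsys_iso m m'.
Proof.
move=> u sw r r'; have [fi fw fe _] := r; have [fi' fw' fe' _] := r'.
have [s Es] : exists s : D -> D, forall d, phi' (s d) = phi d.
  apply: (fin_all_exists (P := fun d d' => phi' d' = phi d)) => d.
  exact: (represents_onto r' u sw).
have si : injective s by move=> x y /(congr1 phi'); rewrite !Es => /fi.
apply/existsP; exists (perm si); apply/forallP => d; rewrite !permE.
apply/andP; split; apply/eqP/fi'.
  by rewrite Es (represents_vrot _ r) (represents_vrot _ r') Es.
by rewrite Es fe fe' Es.
Qed.

Lemma represents_exists w : cubic w -> size w = #|D| ->
  exists m phi, represents w m phi.
Proof.
move=> c sw; pose phi (d : D) := nth (lett 0) w (enum_rank d).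
have fi : injective phi.
  move=> x y /eqP; rewrite nth_uniq ?cubic_uniq ?sw ?ltn_ord //.
  by move/eqP/val_inj/enum_rank_inj.
have fw d : phi d \in w by rewrite mem_nth // sw.
have onto a : a \in w -> exists d, phi d = a.
  move=> aw; have iw : index a w < #|D| by rewrite -sw index_mem.
  by exists (enum_val (Ordinal iw)); rewrite /phi enum_valK nth_index.
have [fe Ee] : exists fe : D -> D, forall d, phi (fe d) = bar (phi d).
  apply: (fin_all_exists (P := fun d d' => phi d' = bar (phi d))) => d.
  by apply: onto; rewrite mem_bar.
have [fr Er] : exists fr : D -> D, forall d, phi (fr d) = next w (bar (phi d)).
  apply: (fin_all_exists (P := fun d d' => phi d' = next w (bar (phi d)))) => d.
  by apply: onto; rewrite mem_next mem_bar.
have ei : injective fe by move=> x y /(congr1 phi); rewrite !Ee => /bar_inj/fi.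
have ri : injective fr.
  by move=> x y /(congr1 phi); rewrite !Er => /(next_inj (cubic_uniq c))/bar_inj/fi.
exists (perm ri, perm ei), phi; split=> // d; first by rewrite permE.
by rewrite faceE !permE Er Ee barK.
Qed.

(** [surgery] fixes the vertex rotation and conjugates [edge], whereas on words [bar] is fixed and
    the vertex rotation is conjugated. Composing [phi] with [switch x y] reconciles the two. *)
Lemma represents_surgery x A B y C E m phi :
  let w := x :: A ++ bar x :: B ++ y :: C ++ bar y :: E in
  let w' := x :: A ++ bar x :: E ++ y :: C ++ bar y :: B in
  cubic w -> size w = #|D| -> represents w m phi ->
  exists i j phi', intertwined m i j /\ represents w' (surgery m i j) phi'.
Proof.
move=> w w' c sw r; have u := cubic_uniq c; have [fi fw fe ff] := r.
have [p Ep] : exists p, map phi p = w.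
  by apply: lift_word => a; apply: represents_onto r u sw.
have [i Ei] : exists i, phi i = x.
  by apply: (represents_onto r u sw); rewrite mem_head.
have [j Ej] : exists j, phi j = y.
  by apply: (represents_onto r u sw); rewrite /w !(inE, mem_cat) eqxx !orbT.
have t d : phi (tperm i j d) = switch x y (phi d).
  rewrite /switch -Ei -Ej !(inj_eq fi).
  by case: tpermP => [->|->|/eqP/negPf-> /eqP/negPf->] //;
    rewrite ?eqxx //; case: eqP => [->|].
have eK := represents_edgeK _ r.
have E1 d : edge (surgery m i j) d = tperm i j (edge m (tperm i j d)).
  by rewrite /surgery /edge /= conjgE tpermV !permM.
have pw : w =i w' := perm_mem (perm_step x y A B C E).
exists i, j, (switch x y \o phi); split.
  have [cp up] := represents_cycle r u Ep.
  have ip : i \in p by rewrite -(mem_map fi) Ep Ei mem_head.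
  apply/orP; left; rewrite /cyclic_order (orbitE cp up ip).
  have -> : index i p = 0 by rewrite -(index_map fi) Ep Ei /= eqxx.
  rewrite rot0.
  have : subseq (map phi [:: i; edge m i; j; edge m j]) (map phi p).
    rewrite Ep /= !fe Ei Ej /w /= eqxx.
    apply: subseq_trans (suffix_subseq A _).
    rewrite /= eqxx; apply: subseq_trans (suffix_subseq B _).
    rewrite /= eqxx; apply: subseq_trans (suffix_subseq C _).
    by rewrite /= eqxx sub0seq.
  exact: subseq_map_inj.
split.
- exact: inj_comp (can_inj (switchK x y)) fi.
- by move=> d; have := fw (tperm i j d); rewrite t pw.
- by move=> d /=; rewrite E1 -!t tpermK fe t bar_switch.
move=> d; rewrite faceE.
change (switch x y (phi (vrot m (edge (surgery m i j) d))) =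
  next w' (switch x y (phi d))).
have sw' : switch x y (phi d) \in w'.
  by have := fw (tperm i j d); rewrite t pw.
rewrite (represents_vrot _ r) (next_step u sw').
by rewrite E1 t fe t !bar_switch !barK.
Qed.

End Representation.

(** * From equivalent words to paths in the surgery graph *)

Section Umaps.
Variable g : nat.
Hypothesis hg : 0 < g.
Let d0 := nseq (4 * g - 2) 3.
Let n := sumn d0.

Lemma size_darts : n = 12 * g - 6.
Proof. rewrite /n /d0 sumn_nseq; lia. Qed.

(** Orbits of sizes 3, 2 and n give 4g - 2 vertices, 6g - 3 edges and one face, whence the genus. *)
Lemma represents_umap w (m : rotsys 'I_n) phi :
  cubic w -> size w = n -> represents w m phi -> is_umap d0 g m.
Proof.
move=> c sw r; have u := cubic_uniq c; have [fi fw fe ff] := r.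
have sw' : size w = #|'I_n| by rewrite card_ord.
have eK d : edge m (edge m d) = d := represents_edgeK d r.
have en d : edge m d != d.
  by apply/eqP => /(congr1 phi)/eqP; rewrite fe bar_neq.
have fv d := represents_vrot d r.
have [_ _ vw] := c.
have vn d : vrot m d != d.
  by apply/eqP => /(congr1 phi)/eqP; rewrite fv; have [/negPf->] := vw _ (fw d).
have v3 d : vrot m (vrot m (vrot m d)) = d.
  by apply: fi; rewrite !fv; have [_ ->] := vw _ (fw d).
have cv d : #|porbit (vrot m) d| = 3 by apply: card_porbit3.
have ce d : #|porbit (edge m) d| = 2 by apply: card_porbit2.
have [p Ep] : exists p, map phi p = w.
  by apply: lift_word => a; apply: represents_onto r u sw'.
have [cp up] := represents_cycle r u Ep.
have cf d : #|porbit (face m) d| = n.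
  rewrite (@card_porbit_cycle _ _ _ p) //; last by rewrite -(mem_map fi) Ep.
  by apply: etrans sw; rewrite -Ep size_map.
have nv := card_porbits_uniform cv; have ne := card_porbits_uniform ce.
have nf := card_porbits_uniform cf; rewrite card_ord in nv ne nf.
have En := size_darts.
have dE : degrees m = nseq (4 * g - 2) 3.
  have /all_pred1P-> : all (pred1 3) (degrees m).
    by apply/allP => _ /imageP[_ /imsetP[d _ ->] ->]; rewrite /= cv.
  by congr nseq; rewrite size_image; rewrite -/n in nv; lia.
apply/and5P; split.
- by apply/forallP => d; rewrite eK eqxx en.
- rewrite /unicellular; rewrite -/n in nf; apply/eqP; nia.
- rewrite /has_genus; rewrite -/n in nf ne nv.
  have -> : #|porbits (face m)| = 1 by nia.
  lia.
- by rewrite dE all_nseq orbT.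
- by rewrite dE.
Qed.

Lemma umap_represents (m : umap d0 g) :
  exists w phi, [/\ cubic w, size w = n & represents w (val m) phi].
Proof.
case: m => m /= /and5P[/forallP ei um _ _ dm].
have eK d : edge m (edge m d) = d by case/andP: (ei d) => /eqP.
have en d : edge m d != d by case/andP: (ei d).
have cv d : #|porbit (vrot m) d| = 3.
  have : #|porbit (vrot m) d| \in degrees m.
    by apply: image_f; rewrite imset_f.
  by rewrite (perm_mem dm) => /nseqP[].
have v3 d : vrot m (vrot m (vrot m d)) = d.
  by have := iter_porbit (vrot m) d; rewrite cv.
have vn d : vrot m d != d.
  have := uniq_traject_porbit (vrot m) d; rewrite cv /= inE negb_or eq_sym.
  by case/andP => /andP[].
have n0 : 0 < n by rewrite size_darts; lia.
(* An edge is named by its smaller dart, and the boolean tells its two darts apart. The word is the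
   face orbit of dart 0. *)
pose x0 := Ordinal n0; pose phi (d : 'I_n) : letter := (minn d (edge m d), d < edge m d).
have fe d : phi (edge m d) = bar (phi d).
  rewrite /phi eK /bar /= minnC; congr (_, _).
  by have := en d; rewrite -val_eqE /=; case: ltngtP.
have fi : injective phi.
  move=> x y [mE]; case: (ltnP x (edge m x)) => hx; case: ltnP => hy // _.
    apply: val_inj; move: mE.
    by rewrite (minn_idPl (ltnW hx)) (minn_idPl (ltnW hy)).
  move: mE; rewrite (minn_idPr hx) (minn_idPr hy) => /val_inj E.
  by rewrite -(eK x) E eK.
have cf := cycle_orbit (@perm_inj _ (face m)) x0.
have all_orbit d : d \in orbit (face m) x0.
  rewrite -fconnect_orbit -porbit_fconnect -eq_porbit_mem.
  move: um; rewrite /unicellular => /cards1P[Z EZ].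
  have inZ e : porbit (face m) e = Z.
    by apply/set1P; rewrite -EZ imset_f.
  by rewrite !inZ.
have uo := orbit_uniq (face m) x0.
have nw d : next (map phi (orbit (face m) x0)) (phi d) = phi (face m d).
  by rewrite next_map //; have /= /eqP-> := next_cycle cf (all_orbit d).
exists (map phi (orbit (face m) x0)), phi; split.
- split; first by rewrite map_inj_uniq.
    by move=> _ /mapP[d _ ->]; rewrite -fe map_f.
  move=> _ /mapP[d _ ->].
  have nv e : next (map phi (orbit (face m) x0)) (bar (phi e)) = phi (vrot m e).
    by rewrite -fe nw faceE eK.
  by rewrite !nv v3 (inj_eq fi) vn.
- rewrite size_map -(card_uniqP uo).
  by rewrite (eq_card (B := 'I_n)) ?card_ord // => d; rewrite all_orbit.
by split=> // d; rewrite ?map_f.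
Qed.

Definition cls (m : umap d0 g) : {set umap d0 g} :=
  [set m' in [set: umap d0 g] | umap_iso m m'].

Lemma umap_iso_equiv : equivalence_rel (@umap_iso d0 g).
Proof. by move=> a b c; apply: rotsys_iso_equiv. Qed.

Lemma cls_class m : cls m \in equivalence_partition (@umap_iso d0 g) [set: umap d0 g].
Proof. by apply/imsetP; exists m. Qed.

Definition class (m : umap d0 g) : umap_class d0 g := exist _ (cls m) (cls_class m).

Lemma classP (C : umap_class d0 g) : exists m, C = class m.
Proof. by case: C => C h; have /imsetP[m _ E] := h; exists m; apply: val_inj. Qed.

Lemma mem_class m m' : (m' \in val (class m)) = umap_iso m m'.
Proof. by rewrite !inE. Qed.

Lemma eq_class m m' : umap_iso m m' -> class m = class m'.
Proof.
move=> h; apply: val_inj; apply/setP => a; rewrite !mem_class.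
by have [_ /(_ h)] := umap_iso_equiv m m' a.
Qed.

(** Quantifying over all representations absorbs the choice of labels: rotations and renamings do
    not change the class. *)
Definition conn w w' := forall (m m' : umap d0 g) phi phi',
  represents w (val m) phi -> represents w' (val m') phi' ->
  connect (surgery_graph d0 g) (class m) (class m').

Lemma same_class w (m m' : umap d0 g) phi phi' : cubic w -> size w = n ->
  represents w (val m) phi -> represents w (val m') phi' -> class m = class m'.
Proof.
move=> c sw r r'; apply/eq_class/(represents_iso (cubic_uniq c) _ r r').
by rewrite card_ord.
Qed.

Lemma umap_exists w : cubic w -> size w = n ->
  exists (m : umap d0 g) phi, represents w (val m) phi.
Proof.
move=> c sw; have [|m [phi r]] := @represents_exists 'I_n w c; first by rewrite card_ord.
by exists (exist _ m (represents_umap c sw r)), phi.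
Qed.

Lemma eqv_conn w w' : eqv w w' -> cubic w -> size w = n -> conn w w'.
Proof.
elim=> {w w'} [w w' _ mv|w|w w' e IH|w1 w2 w3 e1 IH1 e2 IH2] c sw m m' phi phi' r r'.
- case: mv c sw r r' => [k v|f v fi fb|x A B y C E] c sw r r'.
  + rewrite (same_class c sw r (m' := m') (phi' := phi')) ?connect0 //.
    have [i1 i2 i3 i4] := r'; split=> // d; first by rewrite -(mem_rot k).
    by rewrite i4 next_rot ?cubic_uniq.
  + have rf : represents (map f v) (val m) (f \o phi).
      have [i1 i2 i3 i4] := r; split=> /= [|d|d|d].
      * exact: inj_comp.
      * exact: map_f (i2 d).
      * by rewrite (i3 d) fb.
      * by rewrite (i4 d) next_map // cubic_uniq.
    have cf := cubic_map c fi fb; have sf : size (map f v) = n by rewrite size_map.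
    by rewrite (same_class cf sf rf r') connect0.
  + have [|i [j [psi [it rs]]]] := represents_surgery c _ r.
      by rewrite card_ord.
    have c' := cubic_step c.
    have s' := etrans (esym (perm_size (perm_step x y A B C E))) sw.
    pose m1 : umap d0 g :=
      exist (fun m => is_true (is_umap d0 g m)) _ (represents_umap c' s' rs).
    apply: connect1; rewrite (same_class c' s' r' (m' := m1) (phi' := psi)) //.
    have refl_class v : v \in val (class v).
      by rewrite mem_class; have [] := umap_iso_equiv v v v.
    apply/exists_inP; exists m; first exact: refl_class.
    apply/exists_inP; exists m1; first exact: refl_class.
    apply/orP; left; apply/existsP; exists i; apply/existsP; exists j.
    by rewrite it eqxx.
- by rewrite (same_class c sw r r') connect0.
- rewrite (sym_connect_sym (@surgery_graph_sym _ _)).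
  by apply: IH r' r; rewrite ?(eqv_cubic e) ?(eqv_size e).
have c2 := (eqv_cubic e1).1 c; have s2 : size w2 = n by rewrite -(eqv_size e1).
have [m2 [phi2 r2]] := umap_exists c2 s2.
exact: connect_trans (IH1 c sw _ _ _ _ r r2) (IH2 c2 s2 _ _ _ _ r2 r').
Qed.

Lemma surgery_graph_connected : connected_graph (surgery_graph d0 g).
Proof.
split.
  (* [cubic_exists] attaches tori to [theta], which has genus one already; hence [g.-1]. *)
  have [w c sw] := cubic_exists g.-1.
  have [|m _] := umap_exists c; first by rewrite sw size_darts; lia.
  by exists (class m).
move=> C C'; have [m ->] := classP C; have [m' ->] := classP C'.
have [w [phi [c sw r]]] := umap_represents m.
have [w' [phi' [c' sw' r']]] := umap_represents m'.
have e := cubic_eqv c c' (etrans sw (esym sw')).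
exact: eqv_conn e c sw _ _ _ _ r r'.
Qed.
End Umaps.

Theorem theorem1 (g : nat) (hg : 1 <= g) :
  connected_graph (surgery_graph (nseq (4 * g - 2) 3) g).
Proof. exact: surgery_graph_connected hg. Qed.
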